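(* Let $1<p<\infty$. Then $\mathcal{L}(\ell_p,c_0)$, $\mathcal{L}(\ell_1,\ell_p)$, and $\mathcal{L}(\ell_p,\ell_\infty)$ each contain $2^{\mathfrak{c}}$ distinct closed ideals.
   Context: $\mathfrak{c}$ is the cardinality of the continuum. $\mathcal{L}(X,Y)$ is the space of bounded linear operators from $X$ to $Y$, $\mathcal{L}(X)=\mathcal{L}(X,X)$. A closed ideal of $\mathcal{L}(X,Y)$ is a norm-closed linear subspace $\mathcal{J}$ with $ATB\in\mathcal{J}$ for all $A\in\mathcal{L}(Y)$, $T\in\mathcal{J}$, $B\in\mathcal{L}(X)$. *)

(* Defs.v *)
From HB Require Import structures.
From mathcomp Require Import all_boot all_order all_algebra.
From mathcomp Require Import all_classical all_reals all_analysis.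
From mathcomp Require Import ess_sup_inf.
From mathcomp Require complex.

Set Implicit Arguments.
Unset Strict Implicit.
Unset Printing Implicit Defensive.

Import Order.TTheory GRing.Theory Num.Theory.
Import numFieldNormedType.Exports.

Local Open Scope classical_set_scope.
Local Open Scope ring_scope.

(* A field extension of R with an absolute value that takes its values in R
   and extends the one of R. By the Gelfand-Mazur theorem such a field is R or
   the complex numbers R[i]; both instances are given below. MathComp norms
   are valued in the scalar field, hence the R-valued variant [modulus]. *)
Record scalarField (R : realType) := ScalarField {
  scalar :> numFieldType;
  embed : {rmorphism R -> scalar};
  modulus : scalar -> R;
  embed_ge0 : forall r, 0 <= r -> 0 <= embed r;
  embed_modulus : forall x, embed (modulus x) = `|x| }.

Definition realScalars (R : realType) : scalarField R :=
  @ScalarField R R idfun Num.norm (fun _ r0 => r0) (fun _ => erefl).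

Section complex_scalars.
Import complex.
Variable R : realType.

Lemma complex_embed_ge0 (r : R) : 0 <= r -> 0 <= real_complex R r.
Proof. by move=> r0; rewrite lecE/= eqxx. Qed.

Lemma complex_embed_modulus (z : R[i]) :
  real_complex R (complex.Re `|z|) = `|z|.
Proof. by rewrite normc_def. Qed.

Definition complexScalars : scalarField R :=
  @ScalarField R R[i] (real_complex R) (fun z => complex.Re `|z|)
    complex_embed_ge0 complex_embed_modulus.

End complex_scalars.

Section modulus_theory.
Variables (R : realType) (K : scalarField R).
Implicit Types x y : K.

Lemma embed_le (r s : R) : (embed K r <= embed K s) = (r <= s).
Proof.
apply/idP/idP => [rs|]; last first.
  by move=> rs; rewrite -subr_ge0 -rmorphB embed_ge0// subr_ge0.
rewrite leNgt; apply/negP => sr.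
have : embed K s <= embed K r.
  by rewrite -subr_ge0 -rmorphB embed_ge0// subr_ge0 ltW.
move=> /(conj rs)/andP/le_anti/fmorph_inj rsE.
by rewrite rsE ltxx in sr.
Qed.

Lemma modulus_ge0 x : 0 <= modulus x.
Proof. by rewrite -embed_le rmorph0 embed_modulus. Qed.

Lemma modulusM x y : modulus (x * y) = modulus x * modulus y.
Proof. by apply: (fmorph_inj (embed K)); rewrite rmorphM !embed_modulus normrM. Qed.

Lemma modulusD x y : modulus (x + y) <= modulus x + modulus y.
Proof. by rewrite -embed_le rmorphD !embed_modulus ler_normD. Qed.

Lemma modulus0 : modulus (0 : K) = 0.
Proof. by apply: (fmorph_inj (embed K)); rewrite embed_modulus rmorph0 normr0. Qed.

Lemma modulus_eq0 x : modulus x = 0 -> x = 0.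
Proof. by move=> x0; apply/normr0_eq0; rewrite -embed_modulus x0 rmorph0. Qed.

End modulus_theory.


(* The l_p norm, 1 <= p <= +oo, of an arbitrary sequence; it may be +oo. *)
Definition lpnorm (R : realType) (K : scalarField R) (p : \bar R)
    (x : nat -> K) : \bar R :=
  Lnorm counting p (fun n => (modulus (x n))%:E).

Section lpnorm_theory.
Variables (R : realType) (K : scalarField R).
Implicit Types (x y : nat -> K) (p : \bar R).

Lemma lpnorm_EFinE (r : R) x : 0 < r ->
  lpnorm r%:E x = ((\sum_(n <oo) (modulus (x n) `^ r)%:E) `^ r^-1)%E.
Proof.
move=> r0; rewrite /lpnorm Lnorm_counting//; congr (_ `^ _)%E.
by apply: eq_eseriesr => n _; rewrite abse_EFin ger0_norm ?modulus_ge0.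
Qed.

Lemma ae_counting (P : nat -> Prop) :
  (\forall n \ae (@counting nat R), P n) -> forall n, P n.
Proof.
move=> [A [mA A0 PA]] n; apply: contrapT => nPn.
have An : A n by exact: PA.
have : (0 < (counting A : \bar R))%E.
  apply: (@lt_le_trans _ _ (counting [set n])).
    rewrite /counting asboolT; last exact: finite_set1.
    by rewrite fset_set1 finmap.cardfs1 lte01.
  by apply: le_measure; rewrite ?inE// => _ ->.
by rewrite A0 ltxx.
Qed.

Lemma lpnorm_pinftyE x :
  lpnorm +oo%E x = ereal_sup [set (modulus (x n))%:E | n in [set: nat]].
Proof.
have c0 : (0 < (@counting nat R [set: nat]))%E.
  by rewrite /counting asboolF//; exact: infinite_nat.
rewrite /lpnorm unlock /Lnorm c0; apply/eqP; rewrite eq_le; apply/andP; split.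
  apply/ess_supP; apply/nearW => n /=.
  by rewrite ger0_norm ?modulus_ge0//; apply: ereal_sup_ubound; exists n.
apply: ge_ereal_sup => _ [n _ <-].
have := ess_sup_ge (@counting nat R) (abse \o (fun n => (modulus (x n))%:E)).
by move=> /ae_counting/(_ n)/=; rewrite ger0_norm ?modulus_ge0.
Qed.

Lemma lpnorm_ge0 p x : (0 <= lpnorm p x)%E.
Proof. exact: Lnorm_ge0. Qed.

Lemma lpnorm0 p : (1 <= p)%E -> lpnorm p (0 : nat -> K) = 0%E.
Proof.
move=> p1; rewrite /lpnorm.
rewrite (_ : (fun _ => _) = cst 0%E); last first.
  by apply/funext => n /=; rewrite modulus0.
by rewrite Lnorm0// gt_eqF// (lt_le_trans _ p1).
Qed.

Lemma le_lpnorm (p : \bar R) (f g : nat -> R) : (1 <= p)%E ->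
  (forall n, 0 <= f n <= g n) ->
  ('N[@counting nat R]_p [EFin \o f] <= 'N[counting]_p [EFin \o g])%E.
Proof.
have c0 : (0 < (@counting nat R [set: nat]))%E.
  by rewrite /counting asboolF//; exact: infinite_nat.
move=> p1 fg.
have fgn n : `|f n| <= `|g n|.
  have /andP[f0 fgn] := fg n.
  by rewrite !ger0_norm// (le_trans f0).
case: p p1 => [r|_|//]; last first.
  rewrite unlock /Lnorm c0; apply: le_ess_sup; apply/nearW => n /=.
  by rewrite lee_fin.
rewrite lee_fin => r1.
have r0 : 0 < r by rewrite (lt_le_trans _ r1).
rewrite !Lnorm_counting//; apply: gt0_ler_poweR.
- by rewrite invr_ge0 ltW.
- by rewrite in_itv/= leey ?andbT; apply: nneseries_ge0 => n _ _; rewrite lee_fin powR_ge0.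
- by rewrite in_itv/= leey ?andbT; apply: nneseries_ge0 => n _ _; rewrite lee_fin powR_ge0.
apply: lee_nneseries => n _ /=; first by rewrite lee_fin powR_ge0.
by rewrite lee_fin ge0_ler_powR// ?nnegrE// ltW.
Qed.

Lemma lpnormD p x y : (1 <= p)%E ->
  (lpnorm p (x + y)%R <= lpnorm p x + lpnorm p y)%E.
Proof.
move=> p1; pose f (z : nat -> K) n := modulus (z n).
apply: (@le_trans _ _ ('N[counting]_p [EFin \o (f x \+ f y)%R])%E); last first.
  exact: eminkowski.
by apply: le_lpnorm => // n; rewrite modulus_ge0 modulusD.
Qed.

Lemma lpnormZ p a x : (1 <= p)%E -> (lpnorm p x < +oo)%E ->
  lpnorm p (a *: x) = ((modulus a)%:E * lpnorm p x)%E.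
Proof.
move=> p1 xoo; pose f n := modulus (x n).
have fP : f \in Lfun (@counting nat R) p by apply/andP; split; rewrite inE.
have := LnormZ (Lfun_Sub p1 fP) (modulus a).
rewrite ger0_norm ?modulus_ge0// => <-; rewrite /lpnorm; congr (Lnorm _ _ _).
by apply/funext => n /=; rewrite [LHS](congr1 EFin (modulusM a (x n))).
Qed.

Lemma lpnorm_eq0 p x : (1 <= p)%E -> lpnorm p x = 0%E -> x = 0.
Proof.
move=> p1 /Lnorm_eq0_eq0 => /(_ _ (lt_le_trans lte01 p1)) x0.
apply/funext => n; apply: modulus_eq0.
have H : forall n, [set: nat] n -> (modulus (x n))%:E = 0%E by apply: ae_counting; exact: x0.
by have [] := H n I.
Qed.

End lpnorm_theory.


Section lp_space.
Variables (R : realType) (K : scalarField R) (p : \bar R).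

Definition lp_pred of (1 <= p)%E : {pred nat -> K} :=
  [pred x : nat -> K | (lpnorm p x < +oo)%E].

Record lp (p1 : (1 <= p)%E) := Lp {
  lp_val :> nat -> K ;
  _ : lp_val \in lp_pred p1 }.

Variable p1 : (1 <= p)%E.

HB.instance Definition _ := [isSub of lp p1 for @lp_val p1].
HB.instance Definition _ := [Choice of lp p1 by <:].

Lemma lp_submod_closed : submod_closed (lp_pred p1).
Proof.
split=> [|a x y]; rewrite !inE; first by rewrite lpnorm0.
move=> xoo yoo; rewrite (le_lt_trans (lpnormD _ _ p1))//.
by rewrite lpnormZ// lte_add_pinfty// lte_mul_pinfty// lee_fin modulus_ge0.
Qed.

HB.instance Definition _ :=
  GRing.isSubmodClosed.Build K (nat -> K) (lp_pred p1) lp_submod_closed.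
HB.instance Definition _ := [SubChoice_isSubLmodule of lp p1 by <:].

Definition lp_norm (x : lp p1) : K := embed K (fine (lpnorm p x)).

Lemma lp_lty (x : lp p1) : (lpnorm p x < +oo)%E.
Proof. by case: x. Qed.

Lemma lp_fin_num (x : lp p1) : lpnorm p x \is a fin_num.
Proof. by rewrite ge0_fin_numE ?lp_lty// lpnorm_ge0. Qed.

Lemma lp_normD (x y : lp p1) : lp_norm (x + y) <= lp_norm x + lp_norm y.
Proof.
rewrite /lp_norm -rmorphD embed_le -lee_fin EFinD !fineK ?lp_fin_num//.
exact: lpnormD.
Qed.

Lemma lp_normZ (a : K) (x : lp p1) : lp_norm (a *: x) = `|a| * lp_norm x.
Proof.
rewrite /lp_norm [lp_val _]/(a *: (x : nat -> K)) lpnormZ ?lp_lty//.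
by rewrite fineM ?lp_fin_num//= rmorphM embed_modulus.
Qed.

Lemma lp_norm_eq0 (x : lp p1) : lp_norm x = 0 -> x = 0.
Proof.
rewrite -(rmorph0 (embed K)) => /fmorph_inj x0; apply/val_inj => /=.
by apply: (lpnorm_eq0 p1); rewrite -[LHS]fineK ?lp_fin_num// x0.
Qed.

HB.instance Definition _ := Lmodule_isNormed.Build K (lp p1)
  lp_normD lp_normZ lp_norm_eq0.

Lemma lp_normE (x : lp p1) : `|x| = embed K (fine (lpnorm p x)).
Proof. by []. Qed.

End lp_space.
Arguments lp {R} K {p} p1.

Notation l1 K := (lp K (lexx 1%E)).
Notation linf K := (lp K (leey 1%E)).

Section c0_space.
Variables (R : realType) (K : scalarField R).

Definition c0_pred : {pred linf K} :=
  mem [set x : linf K | (fun n => x n) @ \oo --> (0 : K)].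

Record c0 := C0 { c0_val :> linf K ; _ : c0_val \in c0_pred }.

HB.instance Definition _ := [isSub of c0 for c0_val].
HB.instance Definition _ := [Choice of c0 by <:].

Lemma c0_submod_closed : submod_closed c0_pred.
Proof.
split=> [|a x y]; rewrite !inE/=; first exact: cvg_cst.
move=> x0 y0; have := cvgD (cvgM (cvg_cst a) x0) y0.
rewrite mulr0 addr0; exact.
Qed.

HB.instance Definition _ :=
  GRing.isSubmodClosed.Build K (linf K) c0_pred c0_submod_closed.
HB.instance Definition _ := [SubChoice_isSubLmodule of c0 by <:].

Definition c0_norm (x : c0) : K := `|c0_val x|.

Lemma c0_normD x y : c0_norm (x + y) <= c0_norm x + c0_norm y.
Proof. exact: ler_normD. Qed.

Lemma c0_normZ (a : K) x : c0_norm (a *: x) = `|a| * c0_norm x.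
Proof. exact: normrZ. Qed.

Lemma c0_norm_eq0 x : c0_norm x = 0 -> x = 0.
Proof. by move=> /normr0_eq0 x0; exact/val_inj. Qed.

HB.instance Definition _ := Lmodule_isNormed.Build K c0
  c0_normD c0_normZ c0_norm_eq0.

Lemma c0_normE (x : c0) : `|x| = `|c0_val x|.
Proof. by []. Qed.

End c0_space.

Definition bounded_operators (K : numFieldType) (X Y : normedModType K) :
    set (X -> Y) :=
  [set T | linear T /\ exists M : K, forall x, `|T x| <= M * `|x|].

(* The last clause says that J is closed for the operator norm: T belongs to J
   as soon as for every e > 0 there is S in J such that ||T - S|| <= e. *)
Definition closed_ideal (K : numFieldType) (X Y : normedModType K)
    (J : set (X -> Y)) : Prop :=
  [/\ J `<=` @bounded_operators K X Y,
      J 0,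
      forall (a : K) S T, J S -> J T -> J (a *: S + T),
      forall A T B, @bounded_operators K Y Y A -> J T ->
        @bounded_operators K X X B -> J (A \o T \o B) &
      forall T, @bounded_operators K X Y T ->
        (forall e : K, 0 < e ->
          exists2 S, J S & forall x, `|T x - S x| <= e * `|x|) -> J T].

(* [set R] has cardinality 2 ^ continuum. *)
Definition has_2c_closed_ideals (R : realType) (K : numFieldType)
    (X Y : normedModType K) : Prop :=
  ([set: set R] #<= [set J : set (X -> Y) | closed_ideal J])%card.

(* Main.v *)
(* Let u_j in l_p and v_j in l_q (1/p + 1/q = 1) be the normalized indicators of
   finite sets G_j of coordinates, arranged in blocks with disjoint supports. For a
   set M of blocks, T_M is the operator x |-> (<v_j, x>)_j of l_p into c_0 or
   l_infinity, or e_j |-> u_j of l_1 into l_p, restricted to the j whose block is in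
   M. If n is not in M then A T_M B is negligible on block n, in the sense of
   averages over the columns of the block: each entry is controlled by the
   supremum of |<v_j, B u_i>| (resp. |<v_i, A u_j>|) with i in block n and j in
   another block, and this is small for most i because the G_j are nearly disjoint,
   so that few columns correlate with a given vector, whereas block n has many more
   columns than coordinates. Letting M run through an almost disjoint family of
   continuum many sets yields 2^c closed ideals. *)
Require Import Defs.
From mathcomp Require Import all_boot all_order all_algebra.
From mathcomp Require Import all_classical all_reals all_analysis.
From mathcomp Require Import zify ring lra.

Set Implicit Arguments.
Unset Strict Implicit.
Unset Printing Implicit Defensive.

Import Order.TTheory GRing.Theory Num.Theory.
Import numFieldNormedType.Exports.

Local Open Scope classical_set_scope.

(** * Systems of nearly disjoint columns *)

(* A column is a finite subset [supp j] of the coordinates; it carries the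
   vectors |supp j|^(-1/p) 1_(supp j) of l_p. Columns come in blocks living on
   disjoint finite sets of coordinates. The growth conditions say that the
   columns of block n are wide compared with all earlier blocks, and that there
   are many more of them than coordinates. An index that is not a column has
   empty support. *)
Record column_system (e : nat) := ColumnSystem {
  block : nat -> seq nat;
  block_of : nat -> nat;
  supp : nat -> seq nat;
  coord_block : nat -> nat;
  block_supp : nat -> seq nat;
  width : nat -> nat;
  block_uniq : forall n, uniq (block n);
  block_neq0 : forall n, block n != [::];
  block_ofP : forall n j, j \in block n -> block_of j = n;
  supp_uniq : forall j, uniq (supp j);
  supp_out : forall j, j \notin block (block_of j) -> supp j = [::];
  size_supp : forall n j, j \in block n -> size (supp j) = width n;
  supp_coord_block : forall j z, z \in supp j -> coord_block z = block_of j;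
  supp_block_supp : forall j z, z \in supp j -> z \in block_supp (block_of j);
  supp_meet : forall i j, i != j -> count (mem (supp i)) (supp j) <= 1;
  width_gt0 : forall n, 0 < width n;
  width_ge : forall n, (n.+1 ^ e) ^ e.+1 <= width n;
  width_growth : forall n m, n < m -> ((n.+1 * width n) ^ e) ^ e.+1 <= width m;
  block_large : forall n, n.+1 * (n.+1 ^ e *
    (\sum_(m < n) size (block m) + size (block_supp n) * (n.+1 * width n) ^ e)) <= size (block n) }.

(** Under this threshold overlaps are harmless: a column of [J] meets the others in at most [size J]
    points, and even at a cost of [size J ^ e] per point the total stays below its own width. *)
Definition sparse (e : nat) (cs : column_system e) (J : seq nat) : Prop :=
  {in J, forall j, j \in block cs (block_of cs j) /\
    size J ^ e.+1 <= width cs (block_of cs j)}.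

Lemma size_le1 (T : eqType) (s : seq T) :
  uniq s -> {in s &, forall x y, x = y} -> size s <= 1.
Proof.
case: s => [|x [|y s]]//= /andP[+ _] /(_ x y); rewrite !inE !eqxx orbT => + xy.
by rewrite xy// eqxx.
Qed.

(** The exponent [e * e.+1] serves [width_ge] and [width_growth] at once. *)
Fixpoint line_len (e n : nat) : nat :=
  if n is m.+1 then (m.+2 * line_len e m) ^ (e * e.+1) else 1.

(* The columns of block n are the integer lines y = a + b x over 0 <= x < width,
   with 0 <= a, b < Q n: there are (Q n)^2 of them on O(Q n) coordinates, and two
   of them share at most one point. *)
Lemma column_system_exists (e : nat) : 0 < e -> inhabited (column_system e).
Proof.
move=> e0; pose width := line_len e.
have k0 n : 0 < width n by elim: n => // n IH; rewrite expn_gt0 muln_gt0 IH.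
have ee0 : 0 < e * e.+1 by rewrite muln_gt0 e0.
have kS n : n.+2 * width n <= width n.+1
  by rewrite /= -[leqLHS]expn1 leq_pexp2l// muln_gt0 k0.
have kmono : {homo width : m n / m <= n}.
  apply: homo_leq => //; first exact: leq_trans.
  by move=> n; apply: leq_trans (kS n); rewrite leq_pmull.
pose L n := n.+1 ^ e; pose M n := (n.+1 * width n) ^ e.
(* [s] stands for the number of columns in earlier blocks. A block has [Q n ^ 2] columns on O([Q n])
   coordinates, so [block_large] reduces to a lower bound on [Q n] in terms of [s] and the width. *)
pose Qf n s := n.+1 * (L n * (s + width n * (width n).+1 * M n)).+1.
pose S := fix S n := if n is m.+1 then S m + Qf m (S m) ^ 2 else 0.
pose Q n := Qf n (S n).
have Q0 n : 0 < Q n by rewrite muln_gt0.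
pose code (n a b : nat) := pickle (n, (a, b)).
have code_inj n a b n' a' b' : code n a b = code n' a' b' -> [/\ n = n', a = a' & b = b'].
  by move=> /(pcan_inj pickleK)[-> -> ->].
(* The default is harmless: a number that is no code belongs to no block, so its support is
   empty. *)
pose dec (j : nat) : nat * (nat * nat) := odflt (0, (0, 0)) (unpickle j).
have codeK n a b : dec (code n a b) = (n, (a, b)) by rewrite /dec pickleK.
pose block n := [seq code n a b | a <- iota 0 (Q n), b <- iota 0 (Q n)].
pose block_of j := (dec j).1.
pose line n a b := [seq code n x (a + b * x) | x <- iota 0 (width n)].
pose supp j := if j \in block (block_of j) then line (block_of j) (dec j).2.1 (dec j).2.2 else [::].
(* Heights [a + b * x] with [a, b < Q n] and [x < width n] stay below [Q n * (width n).+1]. *)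
pose block_supp n := [seq code n x y | x <- iota 0 (width n), y <- iota 0 (Q n * (width n).+1)].
have blkP n j : j \in block n -> exists a b, [/\ a < Q n, b < Q n & j = code n a b].
  move=> /allpairsP[[a b] []]; rewrite !mem_iota !add0n => /andP[_ ?] /andP[_ ?] ->.
  by exists a, b.
have size_blk n : size (block n) = Q n ^ 2 by rewrite size_allpairs !size_iota.
have block_ofP n j : j \in block n -> block_of j = n.
  by move=> /blkP[a [b [_ _ ->]]]; rewrite /block_of codeK.
have GP j z : z \in supp j -> exists n a b x,
    [/\ a < Q n, b < Q n, x < width n, j = code n a b & z = code n x (a + b * x)].
  rewrite /supp; case: ifPn => // /blkP[a [b [aQ bQ jE]]].
  have -> : dec j = (block_of j, (a, b)) by rewrite {1}jE codeK.
  move=> /mapP[x]; rewrite mem_iota => /andP[_ xk] zE.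
  by exists (block_of j), a, b, x.
have supp_uniq j : uniq (supp j).
  rewrite /supp; case: ifPn => // _.
  by rewrite map_inj_uniq ?iota_uniq// => x y /code_inj[].
have sum_blk n : \sum_(m < n) size (block m) = S n.
  elim: n => [|n IH]; first by rewrite big_ord0.
  by rewrite big_ord_recr IH size_blk.
constructor; apply: (@ColumnSystem e block block_of supp block_of block_supp width) => //.
- move=> n; apply: allpairs_uniq; rewrite ?iota_uniq//.
  by move=> [a b] [a' b'] _ _ /code_inj[_ -> ->].
- by move=> j jb; rewrite /supp (negbTE jb).
- by move=> n j jn; rewrite /supp (block_ofP _ _ jn) jn size_map size_iota.
- by move=> j z /GP[n [a [b [x [_ _ _ -> ->]]]]]; rewrite /block_of !codeK.
- move=> j z /GP[n [a [b [x [aQ bQ xk -> ->]]]]]; rewrite /block_of codeK /=.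
  apply/allpairsP; exists (x, a + b * x); rewrite !mem_iota !add0n; split => //.
  rewrite leq0n andTb [X in (X < _)](_ : _ = a + b * x)//.
  by have := leq_mul (ltnW bQ) (ltnW xk); rewrite mulnS; lia.
- move=> i j ij; rewrite -size_filter; apply: size_le1; first exact: filter_uniq.
  move=> z z'; rewrite !mem_filter /= => /andP[zi zj] /andP[z'i z'j].
  have [n [a [b [x [_ _ _ iE zE]]]]] := GP _ _ zi.
  have [n' [a' [b' [x' [_ _ _ iE' zE']]]]] := GP _ _ z'i.
  have [n1 [a1 [b1 [x1 [_ _ _ jE zE1]]]]] := GP _ _ zj.
  have [n2 [a2 [b2 [x2 [_ _ _ jE' zE2]]]]] := GP _ _ z'j.
  move: iE' jE'; rewrite iE jE => /code_inj[? ? ?] /code_inj[? ? ?]; subst n' a' b' n2 a2 b2.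
  move: zE1 zE2; rewrite zE zE' => /code_inj[? ? xy] /code_inj[_ ? x'y]; subst n1 x1 x2.
  have [-> //|xx] := eqVneq x x'.
  (* Two common points with distinct abscissae determine the slope and the intercept. *)
  suff [aa bb] : a = a1 /\ b = b1 by rewrite iE jE aa bb eqxx in ij.
  clear -xy x'y xx; nia.
- case=> [|n]; first by rewrite !exp1n.
  rewrite -expnM /= leq_exp2r// leq_pmulr//.
- move=> n [|m] //; rewrite ltnS => nm.
  rewrite -expnM /= leq_exp2r// leq_mul// ?kmono//; lia.
- move=> n; rewrite sum_blk size_blk.
  have -> : size (block_supp n) = width n * (Q n * (width n).+1) by rewrite size_allpairs !size_iota.
  rewrite -/(L n) -/(M n).
  have -> : Q n ^ 2 = n.+1 * (L n * (S n + width n * (width n).+1 * M n)).+1 * Q n by rewrite -mulnn.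
  move: (Q n) (Q0 n) (L n) (S n) (width n) (M n) => q q0 l s c m.
  rewrite -[leqRHS]mulnA leq_mul2l; apply/orP; right.
  apply: (@leq_trans (l * (s + c * c.+1 * m) * q)); last by rewrite leq_mul2r leqnSn orbT.
  rewrite -[leqRHS]mulnA leq_mul2l mulnDl; apply/orP; right.
  by rewrite leq_add ?leq_pmulr// [q * _]mulnC mulnA mulnAC.
Qed.

Local Open Scope ring_scope.

(** * Closed ideals from almost disjoint families *)

(** A real a is sent to the codes of the points (n, floor(a n)). For distinct a and b the floors
    differ once |a - b| n > 1, so only finitely many points are common. *)
Lemma almost_disjoint_family (R : realType) : exists N : R -> set nat,
  (forall a m, exists2 n, (m <= n)%N & N a n) /\
  (forall a b, a <> b -> exists m, forall n, (m <= n)%N -> N a n -> ~ N b n).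
Proof.
pose c (a : R) (n : nat) := pickle (n, Num.floor (a * n%:R)).
have c_inj a b n m : c a n = c b m ->
    n = m /\ Num.floor (a * n%:R) = Num.floor (b * m%:R).
  by move=> /(pcan_inj pickleK)[].
exists (fun a => range (c a)); split => [a m|a b ab].
  (* The [m.+1] distinct codes in [s] cannot all lie below [m]. *)
  pose s := [seq c a i | i <- iota 0 m.+1].
  have us : uniq s by rewrite map_inj_uniq ?iota_uniq// => i j /c_inj[].
  have ss : size s = m.+1 by rewrite size_map size_iota.
  have [/allP s_lt|/allPn[n ns]] := boolP (all (fun n => n < m)%N s).
    have : (size s <= size (iota 0 m))%N.
      by apply: uniq_leq_size => // n /s_lt; rewrite mem_iota.
    by rewrite ss size_iota ltnn.
  rewrite -leqNgt => mn; exists n => //.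
  by move: ns => /mapP[i _ ->]; exists i.
have d0 : 0 < `|a - b| by rewrite normr_gt0 subr_eq0; exact/eqP.
pose m := Num.bound (`|a - b|^-1).
(* Past this bound a common code has index [i > m], so that [|a - b| * i > 1], which is impossible
   for two numbers with the same floor. *)
exists (\max_(i < m.+1) c a i).+1 => n mn [i _ ci] [j _ cj].
have /esym/c_inj[ij fl] : c b j = c a i by rewrite ci cj.
rewrite -{}ij in fl; have [im|mi] := leqP i m.
  have := @leq_bigmax _ (fun i : 'I_m.+1 => c a i) (Ordinal (im : (i < m.+1)%N)).
  by move=> /leq_trans/(_ (leqnn _)); rewrite /= ci leqNgt mn.
have : 1 < `|a - b| * i%:R.
  rewrite mulrC -ltr_pdivrMr// mul1r.
  have := archi_boundP (ltW (divr_gt0 ltr01 d0)); rewrite mul1r => /lt_trans; apply.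
  by rewrite ltr_nat.
rewrite -[i%:R in X in X -> _]ger0_norm// -normrM mulrBl.
have := floor_le (a * i%:R); have := floorD1_gt (a * i%:R).
have := floor_le (b * i%:R); have := floorD1_gt (b * i%:R).
rewrite fl !intrD => h1 h2 h3 h4.
rewrite ltNge => /negP; apply.
by rewrite ler_norml; lra.
Qed.

Lemma sum_le_size (K : numDomainType) (I : eqType) (s : seq I) (F : I -> K) (c : K) :
  (forall i, i \in s -> F i <= c) -> \sum_(i <- s) F i <= c * (size s)%:R.
Proof.
move=> Fc; rewrite mulr_natr big_seq (le_trans (ler_sum _ Fc))// -big_seq.
by rewrite big_const_seq count_predT iter_addr addr0.
Qed.

Section bounded_operators_theory.
Variable K : numFieldType.
Implicit Types X Y Z : normedModType K.
Local Notation bounded := (@bounded_operators K _ _).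

(** The order of [K] may be partial and the given bound need not be nonnegative; its absolute value
    is, and still bounds [T]. *)
Lemma bounded_opP X Y (T : X -> Y) : bounded T ->
  exists2 M : K, 0 <= M & forall x, `|T x| <= M * `|x|.
Proof.
move=> [_ [M TM]]; exists `|M| => // x.
rewrite -[`|x|]normr_id -normrM -[`|T x|]normr_id.
have := TM x; move: (normr_ge0 (T x)) => h /[dup] /(le_trans h) h1.
by rewrite !ger0_norm.
Qed.

Lemma bounded_op_id X : bounded (@idfun X).
Proof. by split=> //; exists 1 => x; rewrite mul1r. Qed.

Lemma bounded_op0 X Y : bounded (0 : X -> Y).
Proof.
split=> [a x y|]; first by rewrite /= scaler0 addr0.
by exists 0 => x; rewrite mul0r normr0.
Qed.

Lemma bounded_op_lincomb X Y (a : K) (S T : X -> Y) :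
  bounded S -> bounded T -> bounded (a *: S + T).
Proof.
move=> bS bT; have [[lS _] [lT _]] := (bS, bT).
have [C C0 SC] := bounded_opP bS; have [D D0 TD] := bounded_opP bT.
split=> [b x y|].
  have E u : (a *: S + T) u = a *: S u + T u by [].
  rewrite !E lS lT !scalerDr !scalerA [b * a]mulrC addrACA//.
exists (`|a| * C + D) => x.
have -> : (a *: S + T) x = a *: S x + T x by [].
rewrite (le_trans (ler_normD _ _))// normrZ mulrDl lerD// -mulrA.
by rewrite ler_wpM2l.
Qed.

Lemma bounded_op_comp X Y Z (S : Y -> Z) (T : X -> Y) :
  bounded S -> bounded T -> bounded (S \o T).
Proof.
move=> bS bT; have [[lS _] [lT _]] := (bS, bT).
have [C C0 SC] := bounded_opP bS; have [D D0 TD] := bounded_opP bT.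
split=> [b x y|]; first by rewrite /= lT lS.
by exists (C * D) => x; rewrite (le_trans (SC _))// -mulrA ler_wpM2l.
Qed.

(* Given an almost disjoint family N_a (a in R) and E a set of reals, the
   operators S such that the averages of |f_i (A S B x_i)| over the blocks n in N_a
   tend to 0 for all a notin E and all A, B form a closed ideal. It contains
   T (N_a) exactly when a is in E, because N_a and N_b have finite intersection. *)
Lemma has_2c_closed_idealsP (R : realType) X Y (x : nat -> X) (f : nat -> Y -> K)
    (block : nat -> seq nat) (T : set nat -> X -> Y) :
  (forall i, `|x i| <= 1) -> (forall i, scalar (f i)) ->
  (forall i y, `|f i y| <= `|y|) -> (forall n, block n != [::]) ->
  (forall M, bounded (T M)) ->
  (forall (M : set nat) n i, M n -> i \in block n -> f i (T M (x i)) = 1) ->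
  (forall (M : set nat) (A : Y -> Y) (B : X -> X), bounded A -> bounded B ->
    forall e : K, 0 < e -> exists m, forall n, (m <= n)%N -> ~ M n ->
    \sum_(i <- block n) `|f i (A (T M (B (x i))))| <= e * (size (block n))%:R) ->
  has_2c_closed_ideals R X Y.
Proof.
move=> x1 lf f1 block0 bT T1 Tsmall.
have [N [Ninf Nad]] := almost_disjoint_family R.
pose Phi n S := \sum_(i <- block n) `|f i (S (x i))|.
pose J (E : set R) : set (X -> Y) := [set S | bounded S /\
  forall a, ~ E a -> forall A B, bounded A -> bounded B -> forall e : K, 0 < e ->
  exists m, forall n, (m <= n)%N -> N a n ->
  Phi n (A \o S \o B) <= e * (size (block n))%:R].
have PhiD n S S' : Phi n (S \+ S') <= Phi n S + Phi n S'.
  rewrite /Phi -big_split/=; apply: ler_sum => i _.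
  have := lf i 1 (S (x i)) (S' (x i)); rewrite scale1r mul1r => ->.
  exact: ler_normD.
have PhiZ n a S : (forall i, f i (a *: S (x i)) = a * f i (S (x i))) ->
    Phi n (a \*: S) = `|a| * Phi n S.
  by move=> fa; rewrite /Phi mulr_sumr; apply: eq_bigr => i _; rewrite fa normrM.
have f0 i : f i 0 = 0.
  by have := lf i (-1) 0 0; rewrite scaler0 addr0 mulN1r addNr.
have fZ i a y : f i (a *: y) = a * f i y.
  by have := lf i a y 0; rewrite !addr0 f0 addr0.
have PhiB n S (C : K) : 0 <= C -> (forall y, `|S y| <= C * `|y|) ->
    Phi n S <= C * (size (block n))%:R.
  move=> C0 SC; apply: sum_le_size => i _.
  rewrite (le_trans (f1 i _))// (le_trans (SC _))//.
  by rewrite -[leRHS]mulr1 ler_wpM2l.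
have JE E : closed_ideal (J E).
  split.
  - by move=> S [].
  - split; first exact: bounded_op0.
    move=> a Ea A B [lA _] bB e e0; exists 0%N => n _ _.
    rewrite /Phi big1 ?mulr_ge0// ?ltW// => i _ /=.
    have -> : A 0 = 0.
      by have := lA (-1) 0 0; rewrite scaler0 addr0 scaleN1r addNr.
    by rewrite f0 normr0.
  - move=> c S S' [bS JS] [bS' JS']; split; first exact: bounded_op_lincomb.
    move=> a Ea A B bA bB e e0.
    (* Chosen so that [|c| * e1 + e1 = e / 2]; the added 1 avoids a division by 0. *)
    pose e1 := e / 2 / (`|c| + 1).
    have e10 : 0 < e1 by rewrite !divr_gt0// ltr_wpDl.
    have [m1 H1] := JS a Ea A B bA bB e1 e10.
    have [m2 H2] := JS' a Ea A B bA bB (e / 2) (divr_gt0 e0 (ltr0Sn _ _)).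
    exists (maxn m1 m2) => n; rewrite geq_max => /andP[m1n m2n] Nan.
    have -> : Phi n (A \o (c *: S + S') \o B) =
        Phi n ((c \*: (A \o S \o B)) \+ (A \o S' \o B)).
      by apply: eq_bigr => i _ /=; have [-> _] := bA.
    rewrite (le_trans (PhiD _ _ _))// PhiZ//.
    have -> : e = `|c| * e1 + e1 + e / 2.
      have c0 : `|c| + 1 != 0 by rewrite gt_eqF// ltr_wpDl.
      by rewrite /e1; field.
    rewrite -addrA mulrDl lerD//.
      by rewrite -mulrA ler_wpM2l// H1.
    by rewrite (le_trans (H2 n m2n Nan))// ler_wpM2r// lerDr ltW.
  - move=> A0 S B0 bA0 [bS JS] bB0; split.
      by do 2 apply: bounded_op_comp => //.
    move=> a Ea A B bA bB e e0.
    by have := JS a Ea _ _ (bounded_op_comp bA bA0) (bounded_op_comp bB0 bB) e e0.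
  - move=> S bS clS; split=> // a Ea A B bA bB e e0.
    have [C C0 AC] := bounded_opP bA; have [D D0 BD] := bounded_opP bB.
    (* The error [A \o (S - S') \o B] then has norm at most [C * D * e1 <= e / 2]. *)
    pose e1 := e / 2 / (C * D + 1).
    have e10 : 0 < e1 by rewrite !divr_gt0// ltr_wpDl// mulr_ge0.
    have [S' [bS' JS'] SS'] := clS e1 e10.
    have [m H] := JS' a Ea A B bA bB (e / 2) (divr_gt0 e0 (ltr0Sn _ _)).
    exists m => n mn Nan.
    have -> : Phi n (A \o S \o B) =
        Phi n ((A \o (fun x => S x - S' x) \o B) \+ (A \o S' \o B)).
      apply: eq_bigr => i _ /=; congr (`|f i _|).
      have [lA _] := bA; have := lA 1 (S (B (x i)) - S' (B (x i))) (S' (B (x i))).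
      by rewrite !scale1r subrK.
    rewrite (le_trans (PhiD _ _ _))// [e in leRHS]splitr mulrDl lerD ?H//.
    apply: (@le_trans _ _ (C * (e1 * D) * (size (block n))%:R)).
      apply: PhiB => [|y /=]; first by rewrite mulr_ge0// mulr_ge0// ltW.
      rewrite (le_trans (AC _))// -mulrA ler_wpM2l// (le_trans (SS' _))//.
      by rewrite -mulrA ler_wpM2l// ltW.
    rewrite ler_wpM2r// mulrCA /e1 mulrAC ler_pdivrMr; last by rewrite ltr_wpDl ?mulr_ge0.
    by apply: ler_wpM2l; [rewrite divr_ge0// ltW | rewrite lerDl].
have J_sep E E' : J E = J E' -> E `<=` E'.
  move=> JEE' a Ea; apply: contrapT => E'a.
  have JT : J E (T (N a)).
    split=> // b Eb A B bA bB e e0.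
    have [m1 H1] := Tsmall (N a) A B bA bB e e0.
    have ba : b <> a by move=> ba; rewrite ba in Eb.
    have [m2 H2] := Nad b a ba.
    exists (maxn m1 m2) => n; rewrite geq_max => /andP[m1n m2n] Nbn.
    by apply: H1 => //; exact: H2.
  have [_] : J E' (T (N a)) by rewrite -JEE'.
  (* With identity operators every term of the average is 1, which exceeds 1/2. *)
  move=> /(_ a E'a idfun idfun (bounded_op_id _) (bounded_op_id _) (1 / 2)).
  move=> /(_ (divr_gt0 ltr01 (ltr0Sn _ _)))[m].
  have [n mn Nan] := Ninf a m; move=> /(_ n mn Nan).
  have -> : Phi n (idfun \o T (N a) \o idfun) = (size (block n))%:R.
    rewrite /Phi (eq_big_seq (fun=> 1)); last by move=> i ib; rewrite /= (T1 _ n)// normr1.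
    by rewrite big_const_seq count_predT iter_addr addr0.
  have s0 : 0 < (size (block n))%:R :> K by rewrite ltr0n lt0n size_eq0.
  rewrite -subr_le0 -[X in X - _]mul1r -mulrBl pmulr_lle0// subr_le0.
  by rewrite ler_pdivlMr// mul1r (ler_nat _ 2 1).

have [g] : $|{injfun [set: set R] >-> [set J0 : set (X -> Y) | closed_ideal J0]}|.
  apply/injfunPex; exists J => [E _|E E' _ _ EE']; first exact: JE.
  by apply/seteqP; split; apply: J_sep.
exact: inj_card_le g.
Qed.

End bounded_operators_theory.

(** * Counting the correlated columns *)

(** Over N = [a ^ e] indices of [J] the sum of [F] would be at least t N and at most 2 C N^(1/r').
    Hence t N^(1/r) <= 2 C, while N^(1/r) >= a because r <= e; this contradicts 2 C < t a. *)
Lemma size_lt_exp (R : realType) (e : nat) (r r' C t : R) (a : nat)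
    (J : seq nat) (F : nat -> R) :
  1 < r -> 1 < r' -> r^-1 + r'^-1 = 1 -> r <= e%:R -> 0 <= C ->
  (0 < a)%N -> 2 * C < t * a%:R -> uniq J -> {in J, forall j, t <= F j} ->
  (forall J0 : seq nat, uniq J0 -> {subset J0 <= J} -> size J0 = (a ^ e)%N ->
    \sum_(j <- J0) F j <= C * (2 * (size J0)%:R) `^ r'^-1) ->
  (size J < a ^ e)%N.
Proof.
move=> r1 r'1 rr' re C0 a0 Cta uJ tF HJ; rewrite ltnNge; apply/negP => aJ.
have r0 : 0 < r by rewrite (lt_trans ltr01).
have r'0 : 0 < r' by rewrite (lt_trans ltr01).
set J0 := take (a ^ e) J; have sJ0 : size J0 = (a ^ e)%N by rewrite size_takel.
have J0J : {subset J0 <= J} by move=> x /mem_take.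
have := HJ J0 (take_uniq _ uJ) J0J sJ0; rewrite sJ0.
have : t * (a ^ e)%:R <= \sum_(j <- J0) F j.
  rewrite -sJ0 -subr_ge0 mulr_natr -[t *+ _]addr0 -iter_addr -count_predT.
  rewrite -big_const_seq -sumrB big_seq sumr_ge0// => j jJ.
  by rewrite subr_ge0 tF// J0J.
move=> /le_trans/[apply]; apply/negP; rewrite -ltNge.
pose N : R := (a ^ e)%:R; rewrite -/N.
have N0 : 0 < N by rewrite ltr0n expn_gt0 a0.
have NE : N = N `^ r^-1 * N `^ r'^-1.
  by rewrite -powRD ?rr' ?powRr1 ?ltW//; apply/implyP => _; rewrite gt_eqF.
have aN : a%:R <= N `^ r^-1.
  rewrite /N natrX -powR_mulrn// -powRrM -[leLHS]powRr1//.
  by rewrite ler_powR ?ler1n// ler_pdivlMr// mul1r.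
rewrite powRM// ?ltW//.
have p2 : 2 `^ r'^-1 <= 2 :> R.
  by rewrite -[leRHS]powRr1// ler_powR ?ler1n// invf_le1 ?ltW.
have t0 : 0 < t.
  rewrite -(pmulr_lgt0 _ (_ : 0 < a%:R)) ?ltr0n//.
  by apply: le_lt_trans Cta; rewrite mulr_ge0.
rewrite [in ltRHS]NE !mulrA ltr_pM2r ?powR_gt0//.
rewrite (@le_lt_trans _ _ (2 * C))// 1?mulrC ?ler_wpM2r// 1?mulrC//.
by rewrite (lt_le_trans Cta)// ler_wpM2l// ltW.
Qed.

(* The relevant j are either in an earlier block, and there are few of those, or
   in a later block, and then rho z j >= eps / width for one of the few coordinates
   z of block n; by the r'-estimate each z accounts for few j. By the r-estimate
   each j accounts for few i. *)
Lemma few_bad (R : realType) (e : nat) (cs : column_system e) (r r' C eps : R)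
    (n : nat) (rho gam : nat -> nat -> R) :
  1 < r -> 1 < r' -> r^-1 + r'^-1 = 1 -> r <= e%:R -> r' <= e%:R ->
  0 <= C -> 0 < eps -> 2 * C < eps * n.+1%:R ->
  (forall z J, uniq J ->
    sparse cs J ->
    \sum_(j <- J) rho z j <= C * (2 * (size J)%:R) `^ r'^-1) ->
  (forall j J, uniq J ->
    sparse cs J ->
    \sum_(i <- J) gam i j <= C * (2 * (size J)%:R) `^ r^-1) ->
  (forall i j, gam i j <= \sum_(z <- supp cs i) rho z j) ->
  (n.+1 * size [seq i <- block cs n | `[< exists j,
     [/\ j \in block cs (block_of cs j), block_of cs j != n & (eps <= gam i j)%R] >]] <= size (block cs n))%N.
Proof.
move=> r1 r'1 rr' re r'e C0 e0 Cen H1 H2 H3.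
have kn0 := width_gt0 cs n.
set Bad := seq.filter _ _.
have uBad : uniq Bad by rewrite filter_uniq// block_uniq.
have badP i : exists j, i \in Bad ->
    [/\ j \in block cs (block_of cs j), block_of cs j != n & eps <= gam i j].
  have [|iB] := boolP (i \in Bad); last by exists 0%N.
  by rewrite mem_filter => /andP[/asboolP[j jP] _]; exists j.
have [jf jfP] := choice badP.
(* [Bad] is counted through the fibres of [jf] over its image [Im]: [sizeL] bounds each fibre, [ImS]
   and [sizeM] bound the image. *)
set Im := undup [seq jf i | i <- Bad].
have jfIm i : i \in Bad -> jf i \in Im by move=> iB; rewrite mem_undup map_f.
have sizeBad : (size Bad <= \sum_(j <- Im) size [seq i <- Bad | jf i == j])%N.
  rewrite -sum1_size (eq_bigr (fun j => \sum_(i <- Bad | jf i == j) 1)%N); last first.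
    by move=> j _; rewrite -big_filter sum1_size.
  rewrite (exchange_big_dep xpredT)//= big_seq [leqRHS]big_seq leq_sum// => i iB.
  by rewrite (big_rem (jf i)) ?jfIm//= eqxx.
(* The witness is fixed and the column of block [n] varies, so the exponents trade places;
   [width_ge] makes the families sparse. *)
have sizeL j : j \in Im -> (size [seq i <- Bad | jf i == j] <= n.+1 ^ e)%N.
  move=> jI; apply/ltnW/(@size_lt_exp _ e r' r C eps _ _ (fun i => gam i j)) => //.
  - by rewrite addrC.
  - by rewrite filter_uniq.
  - move=> i; rewrite mem_filter => /andP[/eqP <- iB].
    by have [] := jfP i iB.
  - move=> J0 uJ0 sJ0 szJ0; apply: H2 => // i /sJ0.
    rewrite !mem_filter => /and3P[_ _ ib].
    by rewrite (block_ofP ib) szJ0; split => //; exact: width_ge.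
pose lo := flatten [seq block cs m | m <- iota 0 n].
pose rel z := [seq j <- Im | (n < block_of cs j)%N && (eps / (width cs n)%:R <= rho z j)].
have Im_blk j : j \in Im -> exists2 i, i \in block cs n &
    [/\ j \in block cs (block_of cs j), block_of cs j != n & eps <= gam i j].
  rewrite mem_undup => /mapP[i iB ->]; exists i; last exact: jfP.
  by move: iB; rewrite mem_filter => /andP[].
have ImS : {subset Im <= lo ++ flatten [seq rel z | z <- block_supp cs n]}.
  move=> j jI; have [i ib [jb jn eg]] := Im_blk j jI.
  rewrite mem_cat; have [jltn|njlt|/eqP] := ltngtP (block_of cs j) n; last by rewrite (negbTE jn).
    by apply/orP; left; apply/flatten_mapP; exists (block_of cs j); rewrite ?mem_iota.
  apply/orP; right; have [/hasP[z zG ez]|/hasPn Gz] :=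
      boolP (has (fun z => eps / (width cs n)%:R <= rho z j) (supp cs i)).
    apply/flatten_mapP; exists z; last by rewrite mem_filter njlt ez.
    by rewrite -(block_ofP ib); exact: supp_block_supp.
  (* If [rho z j] is below [eps / width] at each of the [width] coordinates of the column, the sum
     is strictly below [eps]; strictness uses that the support is nonempty. *)
  have : gam i j < eps; last by rewrite ltNge eg.
  apply: le_lt_trans (H3 i j) _; rewrite -[ltRHS](@divfK _ (width cs n)%:R) ?pnatr_eq0 -?lt0n//.
  rewrite -(size_supp ib) mulr_natr -[_ *+ _]addr0 -iter_addr -count_predT -big_const_seq.
  rewrite big_seq [ltRHS]big_seq; apply: ltr_sum => [|z zG].
    have hG : head 0%N (supp cs i) \in supp cs i by rewrite -nth0 mem_nth// (size_supp ib).
    by apply/hasP; exists (head 0%N (supp cs i)).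
  by rewrite count_predT (size_supp ib) ltNge Gz.
(* The smaller threshold [eps / width] is compensated by the base [n.+1 * width cs n]; families of
   the resulting size are sparse in later blocks by [width_growth]. *)
have sizeM z : (size (rel z) <= (n.+1 * width cs n) ^ e)%N.
  apply/ltnW/(@size_lt_exp _ e r r' C (eps / (width cs n)%:R) _ _ (rho z)) => //.
  - by rewrite muln_gt0.
  - by rewrite natrM -mulrA [_^-1 * _]mulrCA mulVf ?mulr1// pnatr_eq0 -lt0n.
  - by rewrite filter_uniq// undup_uniq.
  - by move=> j; rewrite mem_filter => /andP[/andP[]].
  - move=> J0 uJ0 sJ0 szJ0; apply: H1 => // j /sJ0.
    rewrite mem_filter => /andP[/andP[nj _] jI].
    by have [_ _ [jb _ _]] := Im_blk j jI; rewrite szJ0; split => //; exact: width_growth.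
apply: leq_trans (block_large cs n); rewrite leq_mul2l/=.
apply: (leq_trans sizeBad); apply: (@leq_trans (\sum_(j <- Im) n.+1 ^ e)).
  by rewrite big_seq [leqRHS]big_seq leq_sum.
rewrite big_const_seq count_predT iter_addn_0 leq_mul2l; apply/orP; right.
apply: leq_trans (uniq_leq_size (undup_uniq _) ImS) _.
rewrite size_cat !size_flatten /shape -!map_comp !sumnE !big_map leq_add//.
  by rewrite -[X in iota _ X]subn0 big_mkord.
apply: (@leq_trans (\sum_(z <- block_supp cs n) (n.+1 * width cs n) ^ e)%N).
  by apply: leq_sum => z _; exact: sizeM.
by rewrite big_const_seq count_predT iter_addn_0 mulnC.
Qed.

(** * Sequence spaces *)

Section modulus_extra.
Variables (R : realType) (K : scalarField R).
Implicit Types x y : K.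

Lemma modulus_embed (r : R) : 0 <= r -> modulus (embed K r) = r.
Proof.
move=> r0; apply: (fmorph_inj (embed K)).
by rewrite embed_modulus ger0_norm// embed_ge0.
Qed.

Lemma modulus1 : modulus (1 : K) = 1.
Proof. by rewrite -(rmorph1 (embed K)) modulus_embed. Qed.

Lemma modulus_sum (I : Type) (s : seq I) (P : pred I) (F : I -> K) :
  modulus (\sum_(i <- s | P i) F i) <= \sum_(i <- s | P i) modulus (F i).
Proof.
elim/big_ind2 : _ => [|x a y b xa yb|//]; first by rewrite modulus0.
by rewrite (le_trans (modulusD _ _))// lerD.
Qed.

(** Coefficients of this form turn a sum of moduli of values of a functional into its value at a
    single vector. *)
Definition phase x : K := if x == 0 then 0 else embed K (modulus x) / x.

Lemma phaseM x : phase x * x = embed K (modulus x).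
Proof.
rewrite /phase; case: eqVneq => [->|x0]; last by rewrite divfK.
by rewrite modulus0 rmorph0 mul0r.
Qed.

Lemma modulus_phase x : modulus (phase x) <= 1.
Proof.
rewrite /phase; case: eqVneq => [_|x0]; first by rewrite modulus0.
have m0 : modulus x != 0 by apply: contra x0 => /eqP/modulus_eq0 ->.
rewrite -(@ler_pM2r _ (modulus x)) ?lt_def ?m0 ?modulus_ge0// -modulusM divfK//.
by rewrite mul1r modulus_embed ?modulus_ge0.
Qed.

End modulus_extra.

Section lpnorm_extra.
Variables (R : realType) (K : scalarField R).
Implicit Types (h y : nat -> K) (r c : R).

(** Together with its converse [lpnorm_sum_le], this replaces extended-real series by finite partial
    sums. *)
Lemma lpnorm_le r h c : 0 < r -> 0 <= c ->
  (forall Z, \sum_(z < Z) modulus (h z) `^ r <= c `^ r) -> (lpnorm r%:E h <= c%:E)%E.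
Proof.
move=> r0 c0 hc; rewrite lpnorm_EFinE//.
have -> : c%:E = ((c `^ r)%:E `^ r^-1)%E.
  by rewrite poweR_EFin -powRrM divff ?gt_eqF// powRr1.
have s0 : (0 <= \sum_(0 <= z <oo) (modulus (h z) `^ r)%:E)%E.
  by apply: nneseries_ge0 => z _ _; rewrite lee_fin powR_ge0.
apply: gt0_ler_poweR; first by rewrite invr_ge0 ltW.
- by rewrite in_itv/= s0 leey.
- by rewrite in_itv/= leey lee_fin powR_ge0.
apply: lime_le; first by apply: is_cvg_nneseries => z _ _; rewrite lee_fin powR_ge0.
by apply: nearW => Z; rewrite big_mkord sumEFin lee_fin.
Qed.

Lemma lpnorm_sum_le r h c Z : 0 < r -> (lpnorm r%:E h <= c%:E)%E ->
  \sum_(z < Z) modulus (h z) `^ r <= c `^ r.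
Proof.
move=> r0 hc; have c0 : 0 <= c by rewrite -lee_fin (le_trans (lpnorm_ge0 _ _) hc).
have u0 z : (0 <= (modulus (h z) `^ r)%:E)%E by rewrite lee_fin powR_ge0.
rewrite -lee_fin -sumEFin.
have /le_trans : (\sum_(z < Z) (modulus (h z) `^ r)%:E <=
    \sum_(z <oo) (modulus (h z) `^ r)%:E)%E.
  by rewrite -(big_mkord xpredT (fun z => (modulus (h z) `^ r)%:E)) nneseries_lim_ge.
apply; have s0 : (0 <= \sum_(0 <= z <oo) (modulus (h z) `^ r)%:E)%E.
  exact: nneseries_ge0.
move: hc s0; rewrite lpnorm_EFinE//; case: (limn _) => [s| |]//; last first.
  by rewrite poweRyr ?invr_eq0 ?gt_eqF.
rewrite poweR_EFin !lee_fin => sc s0.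
have -> : s = (s `^ r^-1) `^ r by rewrite -powRrM mulVf ?gt_eqF// powRr1.
by rewrite ge0_ler_powR// ?ltW// nnegrE powR_ge0.
Qed.

Lemma lpnorm_coord r h c z : 1 <= r -> (lpnorm r%:E h <= c%:E)%E -> modulus (h z) <= c.
Proof.
move=> r1 hc; have r0 : 0 < r by rewrite (lt_le_trans ltr01).
have c0 : 0 <= c by rewrite -lee_fin (le_trans (lpnorm_ge0 _ _) hc).
have := lpnorm_sum_le z.+1 r0 hc; rewrite big_ord_recr/=.
move=> /(le_trans _) => /(_ (modulus (h z) `^ r)).
rewrite lerDr sumr_ge0; last by move=> i _; rewrite powR_ge0.
move=> /(_ isT) hcr; rewrite leNgt; apply/negP => ch.
have := gt0_ltr_powR r0 c0 (modulus_ge0 (h z)) ch.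
by rewrite ltNge hcr.
Qed.

Lemma sum_uniq_le (F : nat -> R) (s : seq nat) (c : R) : (forall z, 0 <= F z) -> uniq s ->
  (forall Z, \sum_(z < Z) F z <= c) -> \sum_(z <- s) F z <= c.
Proof.
move=> F0 us Fc; pose Z := (\max_(z <- s) z).+1.
apply: le_trans (Fc Z); rewrite -(big_mkord xpredT F).
rewrite (perm_big [seq z <- index_iota 0 Z | z \in s]); last first.
  rewrite uniq_perm// ?filter_uniq// ?iota_uniq// => z.
  rewrite mem_filter mem_index_iota /=; case: (boolP (z \in s)) => //= zs.
  by rewrite ltnS leq_bigmax_seq.
by rewrite big_filter [leRHS](bigID (mem s))/= lerDl sumr_ge0.
Qed.

(** Hölder's inequality for the counting measure, cut down to a finite set of coordinates so that
    the pairing is a finite sum in [K]. *)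
Lemma hoelder_seq (p q : R) h y a b (s : seq nat) : 1 < p -> 1 < q -> p^-1 + q^-1 = 1 ->
  uniq s -> (lpnorm q%:E h <= a%:E)%E -> (lpnorm p%:E y <= b%:E)%E ->
  modulus (\sum_(z <- s) h z * y z) <= a * b.
Proof.
move=> p1 q1 pq us ha yb.
rewrite (le_trans (modulus_sum _ _ _))//.
rewrite (eq_bigr (fun z => modulus (h z) * modulus (y z))); last by move=> z _; exact: modulusM.
apply: sum_uniq_le => // [z|Z]; first by rewrite mulr_ge0// modulus_ge0.
have := @hoelder _ _ R counting (fun z => modulus (h z)) (fun z => modulus (y z)) q p.
move=> /(_ _ _ _ _ _)/le_trans H.
have {}H : (Lnorm (@counting nat R) 1%:E (fun z => (modulus (h z) * modulus (y z))%:E) <= (a * b)%:E)%E.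
  apply: H => //; [exact: lt_trans q1|exact: lt_trans p1|by rewrite addrC|].
  by rewrite EFinM lee_pmul// lpnorm_ge0.
rewrite -lee_fin -sumEFin; apply: le_trans H; rewrite Lnorm_counting// invr1 poweRe1; last first.
  by apply: nneseries_ge0 => z _ _; rewrite poweR_ge0.
rewrite -(big_mkord xpredT (fun z => (modulus (h z) * modulus (y z))%:E)).
rewrite [leRHS](eq_eseriesr (g := fun z => (modulus (h z) * modulus (y z))%:E)).
  by apply: nneseries_lim_ge => z _ _; rewrite lee_fin mulr_ge0// modulus_ge0.
by move=> z _; rewrite abse_EFin poweRe1 ?lee_fin// ger0_norm// mulr_ge0// modulus_ge0.
Qed.

(** Tails of a convergent series tend to 0; this allows truncation to finitely many coordinates. *)
Lemma lpnorm_tail r h c : 0 < r -> (lpnorm r%:E h < +oo)%E -> 0 < c ->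
  exists Z, (lpnorm r%:E (fun z => if (z < Z)%N then 0%R else h z) <= c%:E)%E.
Proof.
move=> r0 hoo c0; pose f z := (modulus (h z) `^ r)%:E.
have f0 z : (0 <= f z)%E by rewrite lee_fin powR_ge0.
have foo : (\sum_(0 <= z <oo) f z < +oo)%E.
  move: hoo; rewrite lpnorm_EFinE// !ltey; apply: contra => /eqP sE.
  by rewrite -/f sE poweRyr// invr_eq0 gt_eqF.
have /fine_cvgP[_] := nneseries_tail_cvg foo (fun k _ => f0 k).
have cr0 : 0 < c `^ r by rewrite powR_gt0.
move=> /cvgrPdist_le/(_ _ cr0)[Z _ /(_ Z (leqnn _))] /=.
have t0 : (0 <= \sum_(Z <= z <oo) f z)%E by apply: nneseries_ge0.
have tfin : (\sum_(Z <= z <oo) f z)%E \is a fin_num.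
  rewrite ge0_fin_numE//; apply: le_lt_trans foo.
  rewrite (nneseries_split 0 Z)// add0n leeDr//.
  by apply: sume_ge0.
rewrite sub0r normrN ger0_norm ?fine_ge0// => tc.
exists Z; apply: lpnorm_le => // [|W]; first exact: ltW.
pose g z : R := modulus (if (z < Z)%N then 0 else h z) `^ r.
have g0 z : 0 <= g z by rewrite powR_ge0.
rewrite -(big_mkord xpredT g).
(* Extending the range to [Z + W] allows a split at [Z] whatever [W] is. *)
apply: (@le_trans _ _ (\sum_(0 <= z < Z + W) g z)).
  by rewrite [leRHS](@big_cat_nat _ _ _ W)// ?leq_addl//= lerDl sumr_ge0.
rewrite (@big_cat_nat _ _ _ Z)// ?leq_addr//= big_nat big1 ?add0r; last first.
  by move=> z /= zZ; rewrite /g zZ modulus0 powR0// gt_eqF.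
apply: le_trans tc; rewrite -lee_fin fineK// -sumEFin.
have -> : (\sum_(Z <= z < Z + W) (g z)%:E = \sum_(Z <= z < Z + W) f z)%E.
  by apply: eq_big_nat => z /andP[Zz _]; rewrite /g ltnNge Zz.
exact: nneseries_lim_ge.
Qed.
End lpnorm_extra.

Lemma sum_ord_mem_le (R : realType) (F : nat -> R) (s : seq nat) Z :
  (forall z, 0 <= F z) -> uniq s ->
  \sum_(z < Z | (z : nat) \in s) F z <= \sum_(z <- s) F z.
Proof.
move=> F0 us; rewrite -(big_mkord (fun z => z \in s) F) -big_filter.
rewrite (perm_big [seq z <- s | (z < Z)%N]); last first.
  rewrite uniq_perm ?filter_uniq ?iota_uniq// => z.
  by rewrite !mem_filter mem_index_iota /= andbC.
by rewrite big_filter [leRHS](bigID (fun z => (z < Z)%N))/= lerDl sumr_ge0.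
Qed.

(** * Upper estimates for sparse families of columns *)

Section columns.
Variables (e : nat) (cs : column_system e) (e0 : (0 < e)%N).
Local Notation block_of := (block_of cs).
Local Notation block := (block cs).
Local Notation supp := (supp cs).

(** A point of [supp j] on no other column contributes 1. At any other point the multiplicity is at
    most [size J], and the cost [size J ^ e] is charged to another column through it. Each other
    column is charged at most once, so the excess is at most [size J ^ e.+1], hence at most
    [size (supp j)] by sparsity. *)
Lemma sum_mult (J : seq nat) j : uniq J -> sparse cs J -> j \in J ->
  (\sum_(z <- supp j) count (fun i => z \in supp i) J ^ e <= 2 * size (supp j))%N.
Proof.
move=> uJ sJ jJ; have [jb Jk] := sJ j jJ.
have mult z : z \in supp j -> (count (fun i => z \in supp i) J ^ e <=
    1 + \sum_(i <- J | (i != j) && (z \in supp i)) size J ^ e)%N.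
  move=> zj; have [/hasP[i iJ /andP[ij zi]]|/hasPn nJ] :=
      boolP (has (fun i => (i != j) && (z \in supp i)) J).
    rewrite (big_rem i)//= ij zi addnA (leq_trans _ (leq_addr _ _))//.
    by rewrite (leq_trans _ (leq_addl _ _))// leq_exp2r// count_size.
  rewrite (@eq_in_count _ _ (pred1 j)) => [|i iJ /=].
    by rewrite count_uniq_mem// jJ exp1n.
  by case: eqVneq (nJ i iJ) => [->|ij] //= /negbTE.
rewrite big_seq (leq_trans (leq_sum _ mult))// -big_seq big_split/= sum1_size.
rewrite mul2n -addnn leq_add2l.
rewrite (exchange_big_dep (fun i => i != j))/=; last by move=> z i _ /andP[].
apply: (@leq_trans (\sum_(i <- J | i != j) size J ^ e)).
  apply: leq_sum => i ij; rewrite -big_filter big_const_seq count_predT iter_addn_0.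
  rewrite size_filter -[leqRHS]muln1 leq_mul2l; apply/orP; right.
  rewrite (@eq_count _ _ (mem (supp i))) ?supp_meet// => z /=.
  by rewrite ij.
rewrite -big_filter big_const_seq count_predT iter_addn_0 size_filter.
rewrite (size_supp jb) (leq_trans _ Jk)// expnSr leq_mul2l count_size orbT//.
Qed.

Variables (R : realType) (K : scalarField R).

Definition col_weight (r : R) j : R := (size (supp j))%:R `^ (- r^-1).

Definition colvec (r : R) j z : K := if z \in supp j then embed K (col_weight r j) else 0.

Lemma col_weight_ge0 r j : 0 <= col_weight r j.
Proof. exact: powR_ge0. Qed.

(* Sparse families of columns are almost disjoint, hence satisfy an upper
   r-estimate, with 2 absorbing the overlaps. *)
Lemma lpnorm_colvecs (r : R) (J : seq nat) (theta : nat -> K) :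
  1 < r -> r <= e%:R -> uniq J -> sparse cs J -> (forall j, modulus (theta j) <= 1) ->
  (lpnorm r%:E (fun z => (\sum_(j <- J) theta j * colvec r j z)%R)
     <= ((2 * (size J)%:R) `^ r^-1)%:E)%E.
Proof.
move=> r1 re uJ sJ th1; have r0 : 0 < r by rewrite (lt_trans ltr01).
apply: lpnorm_le => // Z.
rewrite -[leRHS]powRrM mulVf ?gt_eqF// powRr1 ?mulr_ge0//.
pose m z := count (fun i => z \in supp i) J.
have supp_gt0 j : j \in J -> 0 < (size (supp j))%:R :> R.
  by move=> jJ; have [jb _] := sJ j jJ; rewrite (size_supp jb) ltr0n width_gt0.
(* All columns of [J] through [z] lie in one block and have the same size s. With m columns through
   [z], the sum has modulus at most m s^(-1/r), whose r-th power is at most m^e / s because r <= e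
   and m >= 1. *)
have pt z : modulus (\sum_(j <- J) theta j * colvec r j z) `^ r <=
    \sum_(j <- J | z \in supp j) (m z ^ e)%:R / (size (supp j))%:R.
  have [/hasP[j0 j0J zj0]|/hasPn nJ] := boolP (has (fun i => z \in supp i) J); last first.
    rewrite big_seq big1 => [|j jJ]; last by rewrite /colvec (negbTE (nJ j jJ)) mulr0.
    by rewrite modulus0 powR0 ?gt_eqF// sumr_ge0// => i _; rewrite divr_ge0.
  have sz j : j \in J -> z \in supp j -> size (supp j) = size (supp j0).
    move=> jJ zj; have [jb _] := sJ j jJ; have [j0b _] := sJ j0 j0J.
    by rewrite (size_supp jb) (size_supp j0b) -(supp_coord_block zj) (supp_coord_block zj0).
  have s0 := supp_gt0 _ j0J; set s := (size (supp j0))%:R in s0.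
  apply: (@le_trans _ _ ((m z)%:R `^ r / s)).
    have -> : (m z)%:R `^ r / s = ((m z)%:R * s `^ (- r^-1)) `^ r.
      rewrite powRM// ?powR_ge0// -powRrM mulNr mulVf ?gt_eqF// powR_inv1// ltW//.
    apply: ge0_ler_powR; rewrite ?nnegrE ?modulus_ge0 ?mulr_ge0 ?powR_ge0//; first exact: ltW.
    apply: (le_trans (modulus_sum _ _ _)).
    rewrite /m -sum1_count natr_sum mulr_suml [leRHS]big_mkcond big_seq [leRHS]big_seq.
    apply: ler_sum => j jJ; rewrite modulusM /colvec.
    case: ifPn => zj; last by rewrite modulus0 mulr0.
    rewrite modulus_embed ?col_weight_ge0// ler_pM ?modulus_ge0 ?col_weight_ge0//.
    by rewrite /col_weight sz.
  have m1 : (1 <= m z)%N by rewrite /m -has_count; apply/hasP; exists j0.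
  apply: (@le_trans _ _ ((m z ^ e)%:R / s)).
    rewrite ler_pM2r ?invr_gt0// natrX -powR_mulrn// ler_powR// ler1n//.
  rewrite (big_rem j0)//= zj0 lerDl sumr_ge0// => i _; rewrite divr_ge0//.
apply: le_trans; first by apply: ler_sum => z _; exact: pt.
(* After the exchange each [j] contributes at most 2, by [sum_mult]. *)
rewrite (exchange_big_dep xpredT)//= ; apply: sum_le_size => j jJ.
rewrite -mulr_suml ler_pdivrMr ?supp_gt0//.
have F0 z : 0 <= (m z ^ e)%:R :> R by [].
apply: (le_trans (sum_ord_mem_le Z F0 (supp_uniq cs j))).
by rewrite -natr_sum -natrM ler_nat sum_mult.
Qed.

End columns.

Lemma scalar_sum (K : nzRingType) (V : lmodType K) (phi : V -> K) (I : Type)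
    (s : seq I) (P : pred I) (c : I -> K) (x : I -> V) : scalar phi ->
  phi (\sum_(i <- s | P i) c i *: x i) = \sum_(i <- s | P i) c i * phi (x i).
Proof.
move=> lphi; have phi0 : phi 0 = 0.
  by have := lphi (-1) 0 0; rewrite scaler0 addr0 mulN1r addNr.
by elim/big_rec2 : _ => // i y z _ <-; rewrite lphi.
Qed.

(** * Real-valued norms and unit vectors *)

Section real_norm.
Variables (R : realType) (K : scalarField R).
Implicit Types X Y : normedModType K.

(** Norms take values in [K]; this is the same norm read in [R], where the estimates are made. *)
Definition nrm X (x : X) : R := modulus `|x|.

Lemma nrmE X (x : X) : embed K (nrm x) = `|x|.
Proof. by rewrite /nrm embed_modulus ger0_norm. Qed.

Lemma nrm_ge0 X (x : X) : 0 <= nrm x.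
Proof. exact: modulus_ge0. Qed.

Lemma nrmD X (x y : X) : nrm (x + y) <= nrm x + nrm y.
Proof. by rewrite -(embed_le K) rmorphD !nrmE ler_normD. Qed.

Lemma nrmZ X (a : K) (x : X) : nrm (a *: x) = modulus a * nrm x.
Proof.
by apply: (fmorph_inj (embed K)); rewrite rmorphM !nrmE embed_modulus normrZ.
Qed.

Lemma bounded_nrm X Y (T : X -> Y) : @bounded_operators K X Y T ->
  exists2 C : R, 0 <= C & forall x, nrm (T x) <= C * nrm x.
Proof.
move=> /bounded_opP[M M0 TM]; exists (modulus M) => [|x]; first exact: modulus_ge0.
by rewrite -(embed_le K) rmorphM !nrmE embed_modulus ger0_norm.
Qed.

Lemma nrm_bounded X Y (T : X -> Y) (C : R) : linear T ->
  (forall x, nrm (T x) <= C * nrm x) -> @bounded_operators K X Y T.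
Proof.
move=> lT TC; split=> //; exists (embed K C) => x.
by rewrite -!nrmE -rmorphM embed_le.
Qed.

Lemma lpnormE (p : \bar R) (p1 : (1 <= p)%E) (x : lp K p1) : lpnorm p x = (nrm x)%:E.
Proof.
rewrite /nrm lp_normE modulus_embed ?fineK ?lp_fin_num//.
by rewrite fine_ge0// lpnorm_ge0.
Qed.

Variables (p : R) (p1 : (1 <= p%:E)%E).
Implicit Types x : lp K p1.

Lemma nrm_le x (c : R) : (lpnorm p%:E x <= c%:E)%E -> nrm x <= c.
Proof. by rewrite lpnormE lee_fin. Qed.

Lemma lp_coord x z : modulus (x z) <= nrm x.
Proof.
by apply: (@lpnorm_coord _ _ p) => //; rewrite lpnormE.
Qed.

Lemma mem_lp h (c : R) : (lpnorm p%:E h <= c%:E)%E -> h \in @lp_pred R K _ p1.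
Proof. by move=> hc; rewrite inE (le_lt_trans hc)// ltry. Qed.

Lemma lp_sumE (I : Type) (s : seq I) (P : pred I) (F : I -> lp K p1) z :
  (\sum_(i <- s | P i) F i) z = \sum_(i <- s | P i) F i z.
Proof.
by elim/big_rec2 : _ => // i y x _ <-.
Qed.

Lemma nrm_sum (I : Type) (s : seq I) (P : pred I) (F : I -> lp K p1) :
  nrm (\sum_(i <- s | P i) F i) <= \sum_(i <- s | P i) nrm (F i).
Proof.
elim/big_ind2 : _ => [|x a y b xa yb|//].
  by rewrite /nrm normr0 modulus0.
by rewrite (le_trans (nrmD _ _))// lerD.
Qed.

Lemma lp_unit_subproof z : (lpnorm p%:E (fun z' => (z' == z)%:R%R : K) <= 1%:E)%E.
Proof.
have pge1 : 1 <= p by rewrite -lee_fin.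
have p0 : 0 < p by rewrite (lt_le_trans ltr01).
apply: lpnorm_le => // Z; rewrite powR1.
apply: (@le_trans _ _ (\sum_(z' < Z | (z' : nat) \in [:: z]) 1)).
  rewrite [leRHS]big_mkcond/=; apply: ler_sum => z' _; rewrite inE.
  case: eqP => _; rewrite ?modulus1 ?powR1// modulus0 powR0// gt_eqF//.
by rewrite (le_trans (@sum_ord_mem_le R (fun=> 1) [:: z] Z _ _))// big_seq1.
Qed.

Definition lp_unit z : lp K p1 := Lp (mem_lp (lp_unit_subproof z)).

Lemma nrm_lp_unit z : nrm (lp_unit z) <= 1.
Proof. by apply: nrm_le; exact: lp_unit_subproof. Qed.

End real_norm.

(** * Pairing columns with vectors and functionals *)

Section column_estimates.
Variables (e : nat) (cs : column_system e) (e0 : (0 < e)%N).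
Variables (R : realType) (K : scalarField R).
Local Notation block_of := (block_of cs).
Local Notation block := (block cs).
Local Notation supp := (supp cs).
Local Notation colvec := (colvec cs K).

Lemma colvec_le1 (r : R) j : 1 <= r -> (lpnorm r%:E (colvec r j) <= 1%:E)%E.
Proof.
move=> r1; have r0 : 0 < r by rewrite (lt_le_trans ltr01).
apply: lpnorm_le => // Z; rewrite powR1.
apply: (@le_trans _ _ (\sum_(z < Z | (z : nat) \in supp j) (size (supp j))%:R^-1)).
  rewrite [leRHS]big_mkcond/=; apply: ler_sum => z _; rewrite /colvec.
  case: ifPn => zj; last by rewrite modulus0 powR0// gt_eqF.
  rewrite modulus_embed ?col_weight_ge0// /col_weight -powRrM mulNr mulVf ?gt_eqF//.
  by rewrite powR_inv1.
have F0 (z : nat) : 0 <= (size (supp j))%:R^-1 :> R by rewrite invr_ge0.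
apply: (le_trans (sum_ord_mem_le Z F0 (supp_uniq cs j))).
rewrite big_const_seq count_predT iter_addr addr0 -[leLHS]mulr_natl.
(* An index that is no column has empty support and gives the zero vector. *)
have [->|s0] := eqVneq (size (supp j))%:R (0 : R); first by rewrite mul0r.
by rewrite divff.
Qed.

(** The functional given by [colvec q j], written as a finite sum so that it makes sense on every
    sequence. *)
Definition colpair (q : R) j (y : nat -> K) : K :=
  \sum_(z <- supp j) embed K (col_weight cs q j) * y z.

Lemma colpairE q j y (s : seq nat) : uniq s -> {subset supp j <= s} ->
  colpair q j y = \sum_(z <- s) colvec q j z * y z.
Proof.
move=> us Gs; rewrite [RHS](bigID (fun z => z \in supp j))/= [X in _ + X]big1 ?addr0.
  rewrite -big_filter (perm_big (supp j)).
    by apply: eq_big_seq => z zj; rewrite /colvec zj.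
  rewrite uniq_perm ?filter_uniq ?supp_uniq// => z; rewrite mem_filter.
  by apply/andP/idP => [[]//|zj]; split=> //; exact: Gs.
by move=> z zj; rewrite /colvec (negbTE zj) mul0r.
Qed.

Lemma colpair_scalar q j : scalar (colpair q j).
Proof.
move=> a x y; rewrite /colpair mulr_sumr -big_split/=; apply: eq_bigr => z _.
by rewrite mulrDr mulrCA.
Qed.

Variables p q : R.
Hypotheses (p1 : 1 < p) (q1 : 1 < q) (pq : p^-1 + q^-1 = 1).

Lemma colpair_le j y b : (lpnorm p%:E y <= b%:E)%E -> modulus (colpair q j y) <= b.
Proof.
move=> yb; rewrite (@colpairE _ _ _ (supp j)) ?supp_uniq// -[leRHS]mul1r.
by apply: (hoelder_seq p1 q1 pq) => //; [exact: supp_uniq | exact/colvec_le1/ltW].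
Qed.

Lemma colpair_colvec n j : j \in block n -> colpair q j (colvec p j) = 1.
Proof.
move=> jn; rewrite /colpair big_seq.
rewrite (eq_bigr (fun=> embed K ((size (supp j))%:R^-1))); last first.
  move=> z zj; rewrite /colvec zj -rmorphM /col_weight -powRD.
    by rewrite -opprD addrC pq powR_inv1.
  by rewrite -opprD [q^-1 + _]addrC pq oppr_eq0 oner_eq0.
rewrite -big_seq big_const_seq count_predT iter_addr addr0 -rmorphMn -[X in embed K X]mulr_natl.
rewrite divff ?rmorph1// (size_supp jn) pnatr_eq0 -lt0n width_gt0//.
Qed.

(** By duality: with phases as coefficients, the sum of moduli is the pairing of [y] with one
    combination of columns, whose l_q norm is controlled by [lpnorm_colvecs]. *)
Lemma sum_colpair_le (J : seq nat) y b : uniq J -> sparse cs J -> q <= e%:R ->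
  (lpnorm p%:E y <= b%:E)%E ->
  \sum_(j <- J) modulus (colpair q j y) <= (2 * (size J)%:R) `^ q^-1 * b.
Proof.
move=> uJ sJ qe yb; pose s := undup (flatten [seq supp j | j <- J]).
have Gs j : j \in J -> {subset supp j <= s}.
  by move=> jJ z zj; rewrite mem_undup; apply/flatten_mapP; exists j.
have H : modulus (\sum_(z <- s) (\sum_(j <- J) phase (colpair q j y) * colvec q j z) * y z) <=
    (2 * (size J)%:R) `^ q^-1 * b.
  apply: (hoelder_seq p1 q1 pq) => //; first exact: undup_uniq.
  by apply: (lpnorm_colvecs e0 q1) => // j; exact: modulus_phase.
apply: le_trans H.
rewrite -[leLHS](@modulus_embed _ K) ?sumr_ge0// => [|j _]; last exact: modulus_ge0.
rewrite rmorph_sum/= (eq_bigr (fun z => \sum_(j <- J)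
    phase (colpair q j y) * (colvec q j z * y z)) (r := s)); last first.
  by move=> z _; rewrite mulr_suml; apply: eq_bigr => j _; rewrite mulrA.
rewrite [X in _ <= modulus X]exchange_big/=.
rewrite (eq_big_seq (fun j => \sum_(z <- s)
    phase (colpair q j y) * (colvec q j z * y z)))// => j jJ.
by rewrite -mulr_sumr -colpairE ?undup_uniq ?phaseM//; exact: Gs.
Qed.

Variables (hp : (1 <= p%:E)%E).

Definition lp_col j : lp K hp := Lp (mem_lp hp (colvec_le1 j (ltW p1))).

Lemma nrm_lp_col j : nrm (lp_col j) <= 1.
Proof. by apply: nrm_le; exact: (colvec_le1 j (ltW p1)). Qed.

(** The same duality with the roles exchanged: one functional is tested on the columns of l_p. *)
Lemma sum_col_le (J : seq nat) (phi : lp K hp -> K) (C : R) :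
  uniq J -> sparse cs J -> p <= e%:R -> 0 <= C -> scalar phi ->
  (forall x, modulus (phi x) <= C * nrm x) ->
  \sum_(j <- J) modulus (phi (lp_col j)) <= C * (2 * (size J)%:R) `^ p^-1.
Proof.
move=> uJ sJ pe C0 lphi phiC.
pose h := \sum_(j <- J) phase (phi (lp_col j)) *: lp_col j.
have hE : lp_val h = fun z => \sum_(j <- J) phase (phi (lp_col j)) * colvec p j z.
  by apply/funext => z; rewrite /h lp_sumE.
have hle : nrm h <= (2 * (size J)%:R) `^ p^-1.
  apply: nrm_le; rewrite hE; apply: (lpnorm_colvecs e0 p1) => // j.
  exact: modulus_phase.
apply: (le_trans _ (ler_wpM2l C0 hle)); apply: le_trans (phiC h).
rewrite scalar_sum// (eq_bigr (fun j => embed K (modulus (phi (lp_col j))))); last first.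
  by move=> j _; rewrite phaseM.
by rewrite -rmorph_sum modulus_embed ?sumr_ge0// => j _; exact: modulus_ge0.
Qed.

End column_estimates.

(** By [few_bad] at most a fraction 1/(n+1) of the columns of block n correlate with another block
    by [eps] or more. These contribute at most [b] each, the others at most [D * eps], and each of
    the two shares of the average is at most d/2. *)
Lemma average_vanishes (R : realType) (e : nat) (cs : column_system e) (r r' C D b : R)
    (M : set nat) (rho gam : nat -> nat -> R) (F : nat -> R) :
  1 < r -> 1 < r' -> r^-1 + r'^-1 = 1 -> r <= e%:R -> r' <= e%:R ->
  0 <= C -> 0 <= D -> 0 <= b ->
  (forall z J, uniq J ->
    sparse cs J ->
    \sum_(j <- J) rho z j <= C * (2 * (size J)%:R) `^ r'^-1) ->
  (forall j J, uniq J ->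
    sparse cs J ->
    \sum_(i <- J) gam i j <= C * (2 * (size J)%:R) `^ r^-1) ->
  (forall i j, gam i j <= \sum_(z <- supp cs i) rho z j) ->
  (forall i, F i <= b) ->
  (forall n i eps, 0 < eps -> ~ M n -> i \in block cs n ->
    (forall j, j \in block cs (block_of cs j) -> block_of cs j != n -> gam i j <= eps) ->
    F i <= D * eps) ->
  forall d, 0 < d -> exists m, forall n, (m <= n)%N -> ~ M n ->
    \sum_(i <- block cs n) F i <= d * (size (block cs n))%:R.
Proof.
move=> r1 r'1 rr' re r'e C0 D0 b0 H1 H2 H3 Fb Fgood d d0.
pose eps := d / 2 / (D + 1).
have D1 : 0 < D + 1 by rewrite ltr_wpDl.
have eps0 : 0 < eps by rewrite !divr_gt0.
(* Large enough both for the hypothesis [2 * C < eps * n.+1] of [few_bad] and for the share of the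
   bad columns. *)
pose m := Num.bound (2 * C / eps + 2 * b / d).
have h1 : 0 <= 2 * C / eps by rewrite divr_ge0 ?(ltW eps0)// mulr_ge0.
have h2 : 0 <= 2 * b / d by rewrite divr_ge0 ?(ltW d0)// mulr_ge0.
have hm := archi_boundP (addr_ge0 h1 h2); rewrite -/m in hm.
exists m => n mn Mn.
have hn : 2 * C / eps + 2 * b / d < n.+1%:R.
  by rewrite (lt_le_trans hm)// ler_nat ltnW.
have Cn : 2 * C < eps * n.+1%:R.
  rewrite [ltRHS]mulrC -ltr_pdivrMr// (le_lt_trans _ hn)// lerDl//.
have bn : 2 * b <= d * n.+1%:R.
  rewrite [leRHS]mulrC -ler_pdivrMr// (le_trans _ (ltW hn))// lerDr//.
have := few_bad r1 r'1 rr' re r'e C0 eps0 Cn H1 H2 H3.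
set P := fun i => `[< _ >]; set N := size (block cs n); rewrite size_filter => bad.
have FP i : i \in block cs n -> F i <= D * eps + (if P i then b else 0).
  move=> ib; case: ifPn => [_|/asboolPn nPi].
    by rewrite (le_trans (Fb i))// lerDr mulr_ge0// ltW.
  rewrite addr0; apply: (Fgood n) => // j jb jn; rewrite leNgt; apply/negP => ej.
  by apply: nPi; exists j; split=> //; exact: ltW.
rewrite big_seq (le_trans (ler_sum _ FP))// -big_seq big_split/=.
rewrite -big_mkcond !big_const_seq count_predT !iter_addr !addr0 -/N.
rewrite -[X in _ + X]mulr_natr -[X in X + _]mulr_natr [d in leRHS]splitr mulrDl.
apply: lerD.
  apply: ler_wpM2r => //; rewrite /eps mulrCA ler_piMr ?divr_ge0 ?(ltW d0)//.
  by rewrite ler_pdivrMr// mul1r lerDl.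
have n0 : 0 < n.+1%:R :> R by [].
rewrite -(ler_pM2l n0) mulrCA -natrM.
apply: (@le_trans _ _ (b * N%:R)); first by rewrite ler_wpM2l// ler_nat.
rewrite mulrA; apply: ler_wpM2r => //; lra.
Qed.

(** * The operators *)

Section l1_operator.
Variables (e : nat) (cs : column_system e) (e0 : (0 < e)%N).
Variables (R : realType) (K : scalarField R) (p : R) (p1 : 1 < p) (hp : (1 <= p%:E)%E).
Local Notation block_of := (block_of cs).
Local Notation block := (block cs).
Local Notation supp := (supp cs).
Local Notation coord_block := (coord_block cs).
Local Notation lp_col j := (lp_col cs K p1 hp j).
Implicit Types (a : l1 K) (M : set nat).

(** All columns through [z] belong to a single finite block, so each coordinate of the image under
    [l1_op_fun] is a finite sum. *)
Definition reach z := (\max_(j <- block (coord_block z)) j).+1.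

Lemma lt_reach z j : z \in supp j -> (j < reach z)%N.
Proof.
move=> zj; rewrite ltnS leq_bigmax_seq// (supp_coord_block zj); apply: contraT => jb.
by rewrite (supp_out jb) in zj.
Qed.

Definition l1_op_fun M (a : nat -> K) z : K :=
  \sum_(j < reach z | `[< M (block_of j) >]) a j * colvec cs K p j z.

Lemma l1_op_funE M a z W : (reach z <= W)%N ->
  l1_op_fun M a z = \sum_(j < W | `[< M (block_of j) >]) a j * colvec cs K p j z.
Proof.
move=> zW; rewrite /l1_op_fun.
rewrite (big_ord_widen_cond W (fun j => `[< M (block_of j) >]) (fun j => a j * colvec cs K p j z))//.
rewrite [RHS](bigID (fun j : 'I_W => (j < reach z)%N))/= [X in _ = _ + X]big1 ?addr0//.
move=> j /andP[_]; rewrite /colvec; case: ifPn => [/lt_reach->//|_ _].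
by rewrite mulr0.
Qed.

Lemma l1_sum_le a W : \sum_(j < W) modulus (a j) <= nrm a.
Proof.
have aa : (lpnorm 1%:E a <= (nrm a)%:E)%E by rewrite lpnormE.
have := lpnorm_sum_le W ltr01 aa; rewrite powRr1 ?nrm_ge0//.
by under eq_bigr do rewrite powRr1 ?modulus_ge0//.
Qed.

Lemma l1_op_finite M a W :
  nrm (\sum_(j < W | `[< M (block_of j) >]) a j *: lp_col j) <= nrm a.
Proof.
rewrite (le_trans (nrm_sum _ _ _))// (le_trans _ (l1_sum_le a W))//.
rewrite big_mkcond/=; apply: ler_sum => j _; case: ifP => _; last exact: modulus_ge0.
by rewrite nrmZ ler_piMr ?modulus_ge0// nrm_lp_col.
Qed.

(** On the first [Z] coordinates the image agrees with a finite combination of columns, whose norm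
    is bounded by the triangle inequality. *)
Lemma l1_op_le M a : (lpnorm p%:E (l1_op_fun M a) <= (nrm a)%:E)%E.
Proof.
have p0 : 0 < p by rewrite (lt_trans ltr01).
apply: lpnorm_le => // [|Z]; first exact: nrm_ge0.
pose W := \max_(z < Z) reach z.
pose x := \sum_(j < W | `[< M (block_of j) >]) a j *: lp_col j.
have xa : (lpnorm p%:E x <= (nrm a)%:E)%E by rewrite lpnormE lee_fin l1_op_finite.
apply: le_trans (lpnorm_sum_le Z p0 xa); apply: ler_sum => z _.
rewrite /x lp_sumE (@l1_op_funE _ _ _ W)//.
exact: (@leq_bigmax _ (fun z : 'I_Z => reach z)).
Qed.

Definition l1_op M a : lp K hp := Lp (mem_lp hp (l1_op_le M a)).

Lemma l1_op_linear M : linear (l1_op M).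
Proof.
move=> c a a'; apply/val_inj/funext => z /=.
rewrite -[RHS]/(c * l1_op_fun M a z + l1_op_fun M a' z).
rewrite /l1_op_fun mulr_sumr -big_split/=; apply: eq_bigr => j _.
by rewrite mulrA -mulrDl.
Qed.

Lemma nrm_l1_op M a : nrm (l1_op M a) <= nrm a.
Proof. by apply: nrm_le; exact: l1_op_le. Qed.

Lemma l1_op_unit M n j : M n -> j \in block n -> l1_op M (lp_unit K _ j) = lp_col j.
Proof.
move=> Mn jn; apply/val_inj/funext => z.
rewrite [LHS](@l1_op_funE _ _ _ (maxn (reach z) j.+1)) ?leq_maxl//.
have jW : (j < maxn (reach z) j.+1)%N by rewrite leq_max leqnn orbT.
rewrite (bigD1 (Ordinal jW))/=; last by rewrite (block_ofP jn); exact/asboolP.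
rewrite eqxx mul1r big1 ?addr0// => i /andP[_ ij].
by rewrite -val_eqE/= in ij; rewrite (negbTE ij) mul0r.
Qed.

(** The vector [a] is cut into a finite part, where linearity and the bound [t] on the columns
    apply, and a tail of norm at most [d / (C + 1)], which costs at most [d] by continuity of
    [phi]. *)
Lemma functional_l1_op_le M a (phi : lp K hp -> K) (C t : R) : scalar phi -> 0 <= C -> 0 <= t ->
  (forall x, modulus (phi x) <= C * nrm x) ->
  (forall j, j \in block (block_of j) -> M (block_of j) -> modulus (phi (lp_col j)) <= t) ->
  modulus (phi (l1_op M a)) <= t * nrm a.
Proof.
move=> lphi C0 t0 phiC phit; apply/ler_addgt0Pr => d d0.
have C1 : 0 < C + 1 by rewrite ltr_wpDl.
have aoo : (lpnorm 1%:E a < +oo)%E by rewrite lpnormE ltry.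
have [Z Ztail] := lpnorm_tail ltr01 aoo (divr_gt0 d0 C1).
pose a2 : l1 K := Lp (mem_lp (lexx 1%E) Ztail).
pose x := \sum_(j < Z | `[< M (block_of j) >]) a j *: lp_col j.
have xE : l1_op M a = 1 *: x + l1_op M a2.
  apply/val_inj/funext => z; rewrite scale1r -[RHS]/(x z + l1_op_fun M a2 z).
  rewrite -[LHS]/(l1_op_fun M a z) /x lp_sumE.
  pose W := maxn Z (reach z).
  rewrite !(@l1_op_funE _ _ _ W) ?leq_maxr//.
  rewrite (bigID (fun j : 'I_W => (j < Z)%N))/=; congr (_ + _).
    by rewrite [RHS](big_ord_widen_cond W (fun j => `[< M (block_of j) >])
      (fun j => a j * colvec cs K p j z)) ?leq_maxl.
  rewrite [RHS](bigID (fun j : 'I_W => (j < Z)%N))/= [X in _ = X + _]big1 ?add0r.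
    by apply: eq_bigr => j /andP[_ /negbTE ->].
  by move=> j /andP[_ ->]; rewrite mul0r.
have phi0 : phi 0 = 0.
  by have := lphi (-1) 0 0; rewrite scaler0 addr0 mulN1r addNr.
rewrite xE lphi mul1r (le_trans (modulusD _ _))// lerD//.
  rewrite /x scalar_sum// (le_trans (modulus_sum _ _ _))//.
  apply: (@le_trans _ _ (\sum_(j < Z) t * modulus (a j))); last first.
    by rewrite -mulr_sumr ler_wpM2l// l1_sum_le.
  rewrite big_mkcond/=; apply: ler_sum => j _; case: ifPn => [/asboolP Mj|_]; last first.
    by rewrite mulr_ge0// modulus_ge0.
  rewrite modulusM mulrC.
  have [jb|jb] := boolP ((j : nat) \in block (block_of j)).
    by rewrite ler_wpM2r ?modulus_ge0// phit.
  have -> : lp_col j = 0.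
    by apply/val_inj/funext => z /=; rewrite /colvec (supp_out jb).
  by rewrite phi0 modulus0 mul0r mulr_ge0// modulus_ge0.
rewrite (le_trans (phiC _))//.
have : nrm a2 <= d / (C + 1) by apply: nrm_le.
move=> /(le_trans (nrm_l1_op M a2)) h; apply: (le_trans (ler_wpM2l C0 h)).
by rewrite mulrCA ler_piMr ?(ltW d0)// ler_pdivrMr// mul1r lerDl.
Qed.

End l1_operator.

(** * Negligible averages and the resulting ideals *)

Section many_ideals.
Variables (R : realType) (K : scalarField R) (p q : R).
Hypotheses (p1 : 1 < p) (q1 : 1 < q) (pq : p^-1 + q^-1 = 1).
Variables (hp : (1 <= p%:E)%E).
Variables (e : nat) (cs : column_system e) (e0 : (0 < e)%N).
Hypotheses (pe : p <= e%:R) (qe : q <= e%:R).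
Local Notation block_of := (block_of cs).
Local Notation block := (block cs).
Local Notation X := (lp K hp).
Local Notation lp_col := (lp_col cs K p1 hp).

Lemma colpair_nrm j (x : X) : modulus (colpair cs q j x) <= nrm x.
Proof. by apply: (colpair_le cs p1 q1 pq); rewrite lpnormE. Qed.

Lemma lp_col_sum_unit i :
  lp_col i = \sum_(z <- supp cs i) embed K (col_weight cs p i) *: lp_unit K hp z.
Proof.
apply/val_inj/funext => z; apply: etrans (esym (lp_sumE _ _ _ z)).
rewrite -[LHS]/(colvec cs K p i z) /colvec; case: ifPn => zi; last first.
  rewrite big_seq big1// => z' z'i; rewrite -[LHS]/(_ * (z == z')%:R).
  by case: eqVneq => [zz|]; [rewrite zz z'i in zi | rewrite mulr0].
rewrite (bigD1_seq z) ?supp_uniq//= -[X in _ = X + _]/(_ * (z == z)%:R) eqxx mulr1.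
rewrite big1 ?addr0// => z' /negbTE zz; rewrite -[LHS]/(_ * (z == z')%:R).
by rewrite eq_sym zz mulr0.
Qed.

(** The weights are at most 1. This crude bound suffices to dominate [gam] by the sum of [rho] over
    a support. *)
Lemma modulus_weighted_sum_le (r : R) i (F : nat -> K) : 1 < r ->
  modulus (\sum_(z <- supp cs i) embed K (col_weight cs r i) * F z) <=
  \sum_(z <- supp cs i) modulus (F z).
Proof.
move=> r1; rewrite (le_trans (modulus_sum _ _ _))//; apply: ler_sum => z _.
rewrite modulusM modulus_embed ?col_weight_ge0// ler_piMl ?modulus_ge0//.
rewrite /col_weight; have [->|s0] := eqVneq (size (supp cs i)) 0%N.
  by rewrite powR0// oppr_eq0 invr_eq0 gt_eqF// (lt_trans ltr01).
rewrite powRN invf_le1; last by rewrite powR_gt0// ltr0n lt0n.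
by rewrite -[leLHS](powRr0 (size (supp cs i))%:R) ler_powR// ?ler1n ?lt0n// invr_ge0 ltW// (lt_trans ltr01).
Qed.

(** Treats c_0 and l_infinity together, using only that the norm of [Y] is determined by the
    functionals [f j] as a supremum. Here [average_vanishes] is applied with [rho z j] = |<v_j, B
    e_z>| and [gam i j] = |<v_j, B u_i>|. *)
Lemma ideals_lp_sup (Y : normedModType K) (f : nat -> Y -> K) (T : set nat -> X -> Y) :
  (forall j, scalar (f j)) -> (forall j y, `|f j y| <= `|y|) ->
  (forall y c, 0 <= c -> (forall j, modulus (f j y) <= c) -> nrm y <= c) ->
  (forall M, linear (T M)) ->
  (forall M j x, f j (T M x) = if `[< M (block_of j) >] then colpair cs q j x else 0) ->
  has_2c_closed_ideals R X Y.
Proof.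
move=> lf f1 fsup lT fT.
have TM1 M x : nrm (T M x) <= nrm x.
  apply: fsup => [|j]; first exact: nrm_ge0.
  by rewrite fT; case: ifP => _; [exact: colpair_nrm | rewrite modulus0 nrm_ge0].
apply: (@has_2c_closed_idealsP K R X Y lp_col f block T) => //.
- by move=> i; rewrite -nrmE -(rmorph1 (embed K)) embed_le nrm_lp_col.
- exact: block_neq0.
- by move=> M; apply: (nrm_bounded (C := 1)) => // x; rewrite mul1r.
- move=> M n i Mn ib; rewrite fT (block_ofP ib) asboolT//.
  by rewrite -(colpair_colvec K pq ib).
- move=> M A B bA bB d d0.
  have [CA CA0 AC] := bounded_nrm bA; have [CB CB0 BC] := bounded_nrm bB.
  have [lA _] := bA; have [lB _] := bB.
  have fle i y : modulus (f i y) <= nrm y by rewrite -(embed_le K) embed_modulus nrmE.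
  pose F i := modulus (f i (A (T M (B (lp_col i))))).
  have phil j : scalar (fun x : X => colpair cs q j (B x)).
    by move=> c x y /=; rewrite lB; exact: (colpair_scalar _ q j).
  have d'0 : 0 < modulus d.
    by rewrite lt_def modulus_ge0 andbT; apply: contraTN d0 => /eqP/modulus_eq0 ->; rewrite ltxx.
  (* A positive scalar comes from [R], so the real-valued estimate applies. *)
  have dE : d = embed K (modulus d) by rewrite embed_modulus gtr0_norm.
  have [|||||m Hm] := @average_vanishes R e cs p q CB CA (CA * CB) M
    (fun z j => modulus (colpair cs q j (B (lp_unit K hp z))))
    (fun i j => modulus (colpair cs q j (B (lp_col i)))) F
    p1 q1 pq pe qe CB0 CA0 (mulr_ge0 CA0 CB0) _ _ _ _ _ (modulus d) d'0.
  + move=> z J uJ sJ; rewrite mulrC; apply: (sum_colpair_le e0 p1 q1 pq) => //.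
    by rewrite lpnormE lee_fin (le_trans (BC _))// ler_piMr// nrm_lp_unit.
  + move=> j J uJ sJ; apply: (sum_col_le e0 p1 uJ sJ pe CB0 (phil j)) => x.
    by rewrite (le_trans (colpair_nrm _ _)).
  + move=> i j; rewrite [in leLHS]lp_col_sum_unit (scalar_sum _ _ _ _ (phil j)).
    exact: modulus_weighted_sum_le.
  + move=> i; rewrite (le_trans (fle _ _))// (le_trans (AC _))// ler_wpM2l//.
    by rewrite (le_trans (TM1 _ _))// (le_trans (BC _))// ler_piMr// nrm_lp_col.
  + move=> n i eps eps0 Mn ib small.
    rewrite (le_trans (fle _ _))// (le_trans (AC _))// ler_wpM2l//.
    (* Only columns [j] with block in [M] survive in the supremum; as [n] is not in [M], they lie in
       other blocks. *)
    apply: fsup => [|j]; first exact: ltW.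
    rewrite fT; case: ifPn => [/asboolP Mj|_]; last by rewrite modulus0 ltW.
    have [jb|jb] := boolP (j \in block (block_of j)).
      by apply: small => //; apply: contra_not_neq Mn => <-.
    by rewrite /colpair (supp_out jb) big_nil modulus0 ltW.
  + exists m => n mn Mn; rewrite [in leRHS]dE -(rmorph_nat (embed K)) -rmorphM.
    rewrite (eq_bigr (fun i => embed K (F i))); last by move=> i _; rewrite embed_modulus.
    by rewrite -rmorph_sum embed_le; exact: Hm.
Qed.

(** Now [A] carries the estimates and the exponents p and q are exchanged: [rho z j] is the modulus
    of the coordinate z of A u_j, and [gam i j] = |<v_i, A u_j>|. The vector B e_i is an arbitrary
    one of l_1, handled by [functional_l1_op_le]. *)
Lemma ideals_l1_lp : has_2c_closed_ideals R (l1 K) X.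
Proof.
pose T := @l1_op e cs R K p p1 hp.
apply: (@has_2c_closed_idealsP K R (l1 K) X (lp_unit K _) (fun i y => colpair cs q i y) block T).
- by move=> i; rewrite -nrmE -(rmorph1 (embed K)) embed_le nrm_lp_unit.
- by move=> i c x y; exact: (colpair_scalar _ q i).
- by move=> i y; rewrite -nrmE -embed_modulus embed_le colpair_nrm.
- exact: block_neq0.
- move=> M; apply: (nrm_bounded (C := 1)) => [|x]; first exact: l1_op_linear.
  by rewrite mul1r nrm_l1_op.
- move=> M n i Mn ib; rewrite /T (l1_op_unit _ _ _ Mn ib).
  by rewrite -(colpair_colvec K pq ib).
- move=> M A B bA bB d d0.
  have [CA CA0 AC] := bounded_nrm bA; have [CB CB0 BC] := bounded_nrm bB.
  have [lA _] := bA; have [lB _] := bB.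
  pose F i := modulus (colpair cs q i (A (T M (B (lp_unit K _ i))))).
  have d'0 : 0 < modulus d.
    by rewrite lt_def modulus_ge0 andbT; apply: contraTN d0 => /eqP/modulus_eq0 ->; rewrite ltxx.
  have dE : d = embed K (modulus d) by rewrite embed_modulus gtr0_norm.
  have qp : q^-1 + p^-1 = 1 by rewrite addrC.
  have Bd i : nrm (B (lp_unit K (lexx 1%E) i)) <= CB.
    by rewrite (le_trans (BC _))// ler_piMr// nrm_lp_unit.
  have [|||||m Hm] := @average_vanishes R e cs q p CA CB (CA * CB) M
    (fun z j => modulus ((A (lp_col j)) z))
    (fun i j => modulus (colpair cs q i (A (lp_col j)))) F
    q1 p1 qp qe pe CA0 CB0 (mulr_ge0 CA0 CB0) _ _ _ _ _ (modulus d) d'0.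
  + move=> z J uJ sJ; apply: (sum_col_le e0 p1 uJ sJ pe CA0 (phi := fun x => A x z)) => [c x y|x].
      by rewrite lA.
    by rewrite (le_trans (lp_coord _ _)).
  + move=> j J uJ sJ; rewrite mulrC; apply: (sum_colpair_le e0 p1 q1 pq) => //.
    by rewrite lpnormE lee_fin (le_trans (AC _))// ler_piMr// nrm_lp_col.
  + by move=> i j; exact: modulus_weighted_sum_le.
  + move=> i; rewrite (le_trans (colpair_nrm _ _))// (le_trans (AC _))// ler_wpM2l//.
    by rewrite (le_trans (nrm_l1_op _ _ _ _ _)).
  + move=> n i eps eps0 Mn ib small.
    have := @functional_l1_op_le e cs R K p p1 hp M (B (lp_unit K (lexx 1%E) i))
      (fun x => colpair cs q i (A x)) CA eps.
    move=> /(_ _ CA0 (ltW eps0) _ _)/le_trans -> //.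
    * by move=> c x y /=; rewrite lA; exact: (colpair_scalar _ q i).
    * by move=> x; rewrite (le_trans (colpair_nrm _ _)).
    * by move=> j jb Mj; apply: small => //; apply: contra_not_neq Mn => <-.
    * by rewrite mulrC; apply: ler_wpM2r => //; exact: ltW.
  + exists m => n mn Mn; rewrite [in leRHS]dE -(rmorph_nat (embed K)) -rmorphM.
    rewrite (eq_bigr (fun i => embed K (F i))); last by move=> i _; rewrite embed_modulus.
    by rewrite -rmorph_sum embed_le; exact: Hm.
Qed.

End many_ideals.

(** * Operators into the bounded and the null sequences *)

Section sup_operators.
Variables (R : realType) (K : scalarField R) (p q : R).
Hypotheses (p1 : 1 < p) (q1 : 1 < q) (pq : p^-1 + q^-1 = 1).
Variables (hp : (1 <= p%:E)%E).
Variables (e : nat) (cs : column_system e) (e0 : (0 < e)%N).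
Hypotheses (pe : p <= e%:R) (qe : q <= e%:R).
Local Notation block_of := (block_of cs).
Local Notation X := (lp K hp).
Implicit Types (M : set nat) (x : X).

Lemma linf_coord (y : linf K) j : modulus (y j) <= nrm y.
Proof. by rewrite -lee_fin -lpnormE lpnorm_pinftyE; apply: ereal_sup_ubound; exists j. Qed.

Lemma nrm_linf_le (y : linf K) c : (forall j, modulus (y j) <= c) -> nrm y <= c.
Proof.
move=> yc; rewrite -lee_fin -lpnormE lpnorm_pinftyE.
by apply: ge_ereal_sup => _ [j _ <-]; rewrite lee_fin.
Qed.

Definition sup_op_fun M x j : K := if `[< M (block_of j) >] then colpair cs q j x else 0.

Lemma sup_op_fun_le M x j : modulus (sup_op_fun M x j) <= nrm x.
Proof.
rewrite /sup_op_fun; case: ifP => _; last by rewrite modulus0 nrm_ge0.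
exact: (colpair_nrm p1 q1 pq cs).
Qed.

Lemma sup_op_subproof M x : sup_op_fun M x \in @lp_pred R K _ (leey 1%E).
Proof.
rewrite inE lpnorm_pinftyE (@le_lt_trans _ _ (nrm x)%:E)// ?ltry//.
by apply: ge_ereal_sup => _ [j _ <-]; rewrite lee_fin sup_op_fun_le.
Qed.

Definition linf_op M x : linf K := Lp (sup_op_subproof M x).

Lemma linf_op_linear M : linear (linf_op M).
Proof.
move=> c x y; apply/val_inj/funext => j.
rewrite -[LHS]/(sup_op_fun M (c *: x + y) j).
rewrite -[RHS]/(c * sup_op_fun M x j + sup_op_fun M y j) /sup_op_fun.
by case: ifP => _; [exact: colpair_scalar | rewrite mulr0 addr0].
Qed.

(** A column of index past the reach of the first [Z] coordinates avoids them all, so it only sees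
    the tail of [x], which has small norm. *)
Lemma linf_op_cvg0 M x : linf_op M x \in @c0_pred R K.
Proof.
rewrite inE /=; apply/cvgr0Pnorm_le => eps eps0.
have p0 : 0 < p by rewrite (lt_trans ltr01).
have d0 : 0 < modulus eps.
  by rewrite lt_def modulus_ge0 andbT; apply: contraTN eps0 => /eqP/modulus_eq0 ->; rewrite ltxx.
have [Z Ztail] := lpnorm_tail p0 (lp_lty x) d0.
exists (\max_(z < Z) reach cs z) => // j /= Wj.
suff : modulus (sup_op_fun M x j) <= modulus eps.
  by rewrite -(embed_le K) !embed_modulus (gtr0_norm eps0).
rewrite /sup_op_fun.
case: ifP => _; last by rewrite modulus0 modulus_ge0.
apply: le_trans (colpair_le cs p1 q1 pq j Ztail).
rewrite le_eqVlt; apply/orP; left; apply/eqP; congr (modulus _).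
apply: eq_big_seq => z zj; case: ifPn => // zZ.
have := leq_trans (@leq_bigmax _ (fun z : 'I_Z => reach cs z) (Ordinal zZ)) Wj.
by rewrite leqNgt lt_reach.
Qed.

Definition c0_op M x : c0 K := C0 (linf_op_cvg0 M x).

Lemma c0_op_linear M : linear (c0_op M).
Proof. by move=> c x y; apply/val_inj; exact: linf_op_linear. Qed.

Lemma ideals_lp_linf : has_2c_closed_ideals R X (linf K).
Proof.
apply: (@ideals_lp_sup R K p q p1 q1 pq hp e cs e0 pe qe (linf K) (fun j y => y j) linf_op) => //.
- by move=> j y; rewrite -embed_modulus -nrmE embed_le linf_coord.
- by move=> y c _; exact: nrm_linf_le.
- exact: linf_op_linear.
Qed.

Lemma ideals_lp_c0 : has_2c_closed_ideals R X (c0 K).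
Proof.
apply: (@ideals_lp_sup R K p q p1 q1 pq hp e cs e0 pe qe (c0 K) (fun j y => y j) c0_op) => //.
- by move=> j y; rewrite -embed_modulus -nrmE embed_le; exact: linf_coord.
- by move=> y c _; exact: nrm_linf_le.
- exact: c0_op_linear.
Qed.

End sup_operators.

Theorem corollary12 (R : realType) (K : scalarField R) (p : R)
    (hp : (1 < p%:E)%E) :
  [/\ has_2c_closed_ideals R (lp K (ltW hp)) (c0 K),
      has_2c_closed_ideals R (l1 K) (lp K (ltW hp)) &
      has_2c_closed_ideals R (lp K (ltW hp)) (linf K)].
Proof.
have p1 : 1 < p by rewrite -lte_fin.
have p0 : 0 < p by rewrite (lt_trans ltr01).
pose q := p / (p - 1).
have q1 : 1 < q by rewrite ltr_pdivlMr ?subr_gt0// mul1r ltrBlDl ltrDr.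
have pq : p^-1 + q^-1 = 1.
  by rewrite /q invf_div -{1}[p^-1]mul1r -mulrDl addrC subrK divff// gt_eqF.
(* A single integer above both p and its conjugate exponent lets one column system serve both
   estimates. *)
pose e := Num.bound (p + q).
have pqe : p + q < e%:R by rewrite archi_boundP// addr_ge0 ?ltW// (lt_trans ltr01).
have pe : p <= e%:R by rewrite (le_trans _ (ltW pqe))// lerDl ltW// (lt_trans ltr01).
have qe : q <= e%:R by rewrite (le_trans _ (ltW pqe))// lerDr ltW.
have e0 : (0 < e)%N by rewrite -(ltr0n R) (lt_le_trans p0).
have [cs] := column_system_exists e0.
split.
- exact: (ideals_lp_c0 K p1 q1 pq (ltW hp) cs e0 pe qe).
- exact: (ideals_l1_lp K p1 q1 pq (ltW hp) cs e0 pe qe).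
- exact: (ideals_lp_linf K p1 q1 pq (ltW hp) cs e0 pe qe).
Qed.
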